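(* Let $n$ be a positive integer coprime with $6$. Then $$\sum_{k=0}^{n-1}\frac{(q;q^2)_k^2 (q;q^2)_{2k}}{(q^2;q^2)_{2k}(q^6;q^6)_k^2}[8k+1]q^{2k^2}\equiv q^{-(n-1)/2}[n]\left(\frac{-3}{n}\right) \pmod{[n]\Phi_n(q)^2}$$ and $$\sum_{k=0}^{(n-1)/2}\frac{(q;q^2)_k^2 (q;q^2)_{2k}}{(q^2;q^2)_{2k}(q^6;q^6)_k^2}[8k+1]q^{2k^2}\equiv q^{-(n-1)/2}[n]\left(\frac{-3}{n}\right) \pmod{[n]\Phi_n(q)^2}.$$
   Context: Here $q$ is an indeterminate, $(x;y)_k=\prod_{j=0}^{k-1}(1-xy^j)$ (with $(x;y)_0=1$), $[k]=\frac{1-q^k}{1-q}$, and $\Phi_n(q)=\prod_{1\le j\le n,\ \gcd(j,n)=1}(q-e^{2\pi i j/n})\in\mathbb Z[q]$ is the $n$-th cyclotomic polynomial. The symbol $\left(\frac{-3}{n}\right)$ is the quadratic character modulo $3$: it equals $1,-1,0$ according to $n\equiv 1,2,0\pmod 3$. For rational functions $A(q),B(q)\in\mathbb Z(q)$ and a polynomial $P(q)\in\mathbb Z[q]$, the congruence $A(q)\equiv B(q)\pmod{P(q)}$ means that $A(q)-B(q)=A_1(q)/A_2(q)$ with $A_1,A_2\in\mathbb Z[q]$, where $P$ divides $A_1$ and $P$ is coprime with $A_2$. *)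

(* Defs.v *)
From HB Require Import structures.
From mathcomp Require Import all_boot all_order all_algebra all_field.

Set Implicit Arguments.
Unset Strict Implicit.
Unset Printing Implicit Defensive.

Import GRing.Theory.
Local Open Scope ring_scope.

(* The fraction field of Z[q], that is Q(q); the indeterminate of {poly int}
   plays the role of q. *)
Notation Zq := {poly int}.
Notation Qq := {fraction {poly int}}.

Definition ratfun (p : Zq) : Qq := FracField.tofrac p.

Definition q : Qq := ratfun 'X.

Definition qpoch (x y : Qq) (k : nat) : Qq :=
  \prod_(0 <= j < k) (1 - x * y ^+ j).

Definition qnum (k : nat) : Qq := (1 - q ^+ k) / (1 - q).

(* [k] as an element of Z[q], needed where it occurs in a modulus;
   see qnum_polyE. *)
Definition qnum_poly (k : nat) : Zq := \sum_(0 <= i < k) 'X^i.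

Lemma qnum_polyE (k : nat) : ratfun (qnum_poly k) = qnum k.
Proof.
have q_neq1 : 1 - q != 0.
  rewrite /q /ratfun -tofrac1 -tofracB tofrac_eq0 subr_eq0 eq_sym.
  by apply/eqP => /(congr1 (fun p : Zq => size p)); rewrite size_polyX size_poly1.
apply: (mulIf q_neq1); rewrite /qnum divfK //.
rewrite /q /ratfun -tofrac1 -tofracXn -!tofracB -tofracM; congr FracField.tofrac.
by rewrite -(opprB _ 1) mulrN mulrC /qnum_poly big_mkord -subrX1 opprB.
Qed.

(* The quadratic character modulo 3. *)
Definition legendre_m3 (n : nat) : int :=
  match (n %% 3)%N with
  | 0%N => 0
  | 1%N => 1
  | _ => -1
  end.

(* Divisibility in Z[q] itself: polydiv's %| on {poly int} is
   pseudo-divisibility, which ignores integer content. *)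
Definition Zq_dvd (D A : Zq) : Prop := exists Q : Zq, A = Q * D.

Definition Zq_coprime (A B : Zq) : Prop :=
  forall D : Zq, Zq_dvd D A -> Zq_dvd D B -> D \is a GRing.unit.

Definition congr_ratfun (A B : Qq) (P : Zq) : Prop :=
  exists A1 A2 : Zq,
    [/\ A2 != 0, A - B = ratfun A1 / ratfun A2, Zq_dvd P A1 & Zq_coprime P A2].

Definition summand (k : nat) : Qq :=
  (qpoch q (q ^+ 2) k ^+ 2 * qpoch q (q ^+ 2) (2 * k)%N)
  / (qpoch (q ^+ 2) (q ^+ 2) (2 * k)%N * qpoch (q ^+ 6) (q ^+ 6) k ^+ 2)
  * qnum (8 * k + 1)%N * q ^+ (2 * k ^ 2)%N.

(* Main.v *)
Require Import Defs.
From mathcomp Require Import all_boot all_order all_algebra all_field.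
From mathcomp Require Import ring zify.

Set Implicit Arguments.
Unset Strict Implicit.
Unset Printing Implicit Defensive.

Import GRing.Theory.
Local Open Scope ring_scope.

(** Replace the repeated factor (q;q^2)_k^2 / (q^6;q^6)_k^2 of the summand by
    prod_(j<k) (1 - a q^(2j+1)) (a - q^(2j+1))
      / prod_(1<=j<=k) (1 - a q^(6j)) (a - q^(6j)),
    which gives it back at a = 1.  Clearing denominators, the parametrised sum
    is S(a) = N(a) / D(a) with N and D polynomials in a.  Everything rests on a
    single telescoping identity [full_term_certificate] in the style of Wilf and
    Zeilberger, which links S(a) to S(a q^6) and is used in two ways.

    At a = q^-n the sum terminates.  Going from n to n - 6 with the recurrence
    evaluates it exactly, and S(q^n) = S(q^-n) = R, the right-hand side
    [terminating].

    When q is a primitive n-th root of unity, the recurrence between N(a) and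
    N(a q^6) has one coefficient with a zero that forces a root of N, and this
    root then propagates along a, a q^6, a q^12, ...  This yields more roots
    than the degree of N allows, so N = 0 [numer_poly_eq0].

    For the lower half of the sum, k <= (n-1)/2, consider M = N - R D over Q(q).
    Its coefficients vanish at every primitive n-th root of unity, and it is
    divisible by (a - q^n) (a - q^-n).  At a = 1 these two factors contribute
    Phi_n^2 and the coefficients of the quotient contribute a third Phi_n
    [order_ge_lower_half].

    For the upper half put k = (n+1)/2 + i.  The factor that does not depend on
    i has order 2 at Phi_n, and at a root of unity the sum over i belongs to the
    same family with q^(2k) replaced by q times q^(2i); it vanishes by the same root
    count, so the order is 3 [order_ge_upper_half].  This is why the family
    below carries a shift y, equal to 1 or to q.

    At a primitive d-th root of unity with d a proper divisor of n, the term of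
    index l d + r specialises to a constant C_l times the term of index r, or to
    0 when r > d/2, so that the sum over each block of d terms vanishes
    [ev_block, ev_half_block].

    Finally, the modulus is the product of the powers Phi_d^(e_d) over the
    divisors d > 1 of n, with e_n = 3 and e_d = 1 otherwise; these are pairwise
    coprime and monic, so the orders at roots of unity give divisibility of the
    reduced numerator in Z[q] [congr_of_orders]. *)

(** * The one-parameter family and its telescoping certificate *)

Lemma coprime6_odd n : coprime n 6 -> odd n.
Proof.
by rewrite (_ : 6 = 2 * 3)%N // coprimeMr coprime_sym coprime2n => /andP[].
Qed.

Lemma coprime6_coprime3 n : coprime n 6 -> coprime n 3.
Proof. by rewrite (_ : 6 = 2 * 3)%N // coprimeMr => /andP[]. Qed.

Section Core.
Variables (F : fieldType) (q y : F).

Definition poch (x p : F) (k : nat) : F := \prod_(0 <= j < k) (1 - x * p ^+ j).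
(** The factor (1 - a u)(1 - u / a), multiplied by a to keep it polynomial in a;
    at a = 1 it is (1 - u)^2. *)
Definition quad (a u : F) : F := (1 - a * u) * (a - u).

(** The factors free of a, where y q^(2k) stands in for the q^(2k) of the
    summand. *)
Definition coef_term (k : nat) : F :=
  poch (y ^+ 2 * q) (q ^+ 2) (2 * k) / poch (y ^+ 2 * q ^+ 2) (q ^+ 2) (2 * k)
  * q ^+ (2 * k ^ 2) * y ^+ (2 * k).

(** The denominator starts at j = 0, one factor earlier than in the summand.
    With this normalisation the recurrence in a has the same coefficients for
    y = 1 and for y = q. *)
Definition quad_ratio (a : F) (k : nat) : F :=
  (\prod_(0 <= j < k) quad a (y * q ^+ (2 * j + 1)))
  / \prod_(0 <= j < k.+1) quad a (y ^+ 3 * q ^+ (6 * j)).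

Definition full_term (a : F) (k : nat) : F :=
  (1 - y ^+ 4 * q ^+ (8 * k + 1)) * coef_term k * quad_ratio a k.

Lemma pochS x p k : poch x p k.+1 = poch x p k * (1 - x * p ^+ k).
Proof. by rewrite /poch big_nat_recr. Qed.

Lemma coef_termS k (x := y * q ^+ (2 * k)) :
  coef_term k.+1 = coef_term k * ((1 - x ^+ 2 * q) * (1 - x ^+ 2 * q ^+ 3)
    / ((1 - x ^+ 2 * q ^+ 2) * (1 - x ^+ 2 * q ^+ 4)) * (q ^+ 2 * x ^+ 2)).
Proof.
rewrite /coef_term (_ : 2 * k.+1 = (2 * k).+2)%N; last by lia.
rewrite !pochS (_ : 2 * k.+1 ^ 2 = 2 * k ^ 2 + (4 * k + 2))%N; last by lia.
set Q := q ^+ (2 * k).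
have e1 : (q ^+ 2) ^+ (2 * k) = Q ^+ 2 by rewrite exprAC.
have e2 : (q ^+ 2) ^+ (2 * k).+1 = Q ^+ 2 * q ^+ 2 by rewrite exprSr e1.
have e3 : q ^+ (2 * k ^ 2 + (4 * k + 2)) = q ^+ (2 * k ^ 2) * (Q ^+ 2 * q ^+ 2).
  by rewrite /Q -exprM -!exprD; congr (q ^+ _); lia.
rewrite (_ : y ^+ (2 * k).+2 = y ^+ (2 * k) * y ^+ 2); last by rewrite -exprD addn2.
rewrite e1 e2 e3 -/Q /x {e1 e2 e3 x}.
rewrite !exprMn.
rewrite (_ : 1 - y ^+ 2 * q * (Q ^+ 2 * q ^+ 2) = 1 - y ^+ 2 * Q ^+ 2 * q ^+ 3); last by ring.
rewrite (_ : 1 - y ^+ 2 * q ^+ 2 * (Q ^+ 2 * q ^+ 2) = 1 - y ^+ 2 * Q ^+ 2 * q ^+ 4); last by ring.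
rewrite (_ : 1 - y ^+ 2 * q ^+ 2 * Q ^+ 2 = 1 - y ^+ 2 * Q ^+ 2 * q ^+ 2); last by ring.
rewrite -[q ^+ (2 * k)]/Q; move: (poch _ _ _) (poch _ _ _) (q ^+ (2 * _)) (y ^+ (2 * _)) => A B C D.
rewrite !invfM; ring.
Qed.

Lemma xcube k : y ^+ 3 * q ^+ (6 * k) = (y * q ^+ (2 * k)) ^+ 3.
Proof. by rewrite exprMn -exprM; congr (_ * _ ^+ _); lia. Qed.

Lemma xcubeS k : y ^+ 3 * q ^+ (6 * k.+1) = (y * q ^+ (2 * k)) ^+ 3 * q ^+ 6.
Proof. by rewrite mulnS addnC exprD mulrA xcube. Qed.

Lemma quad_ratioS a k (x := y * q ^+ (2 * k)) :
  quad_ratio a k.+1 = quad_ratio a k * (quad a (x * q) / quad a (x ^+ 3 * q ^+ 6)).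
Proof.
rewrite /quad_ratio big_nat_recr //= [X in _ / X = _]big_nat_recr //= invfM.
have -> : y * q ^+ (2 * k + 1) = x * q by rewrite exprD mulrA.
by rewrite xcubeS mulrACA.
Qed.

Variables (a : F) (m : nat).

(** A rational multiple of the general term, found by undetermined coefficients
    in x = y q^(2k); comparing degrees in x shows that the unknown polynomial is
    the constant q (1 - a^2 q^6).  The certificate vanishes at k = 0 through 1 - x^2 when y = 1 and through q^2 - x^2 when y = q. *)
Definition certificate (k : nat) : F := let x := y * q ^+ (2 * k) in
  (a - 1) * q * (1 - a ^+ 2 * q ^+ 6) * (1 - x ^+ 2) * (q ^+ 2 - x ^+ 2)
  * (a - x ^+ 3) * coef_term k * quad_ratio a k
  / ((a * q ^+ 5 - x) * (a * q ^+ 3 - x) * (a * q - x)).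

(* The hypotheses den1 to den5 say that no denominator met below vanishes. *)
Hypothesis q_neq0 : q != 0.
Hypothesis yP : y = 1 \/ y = q.
Hypothesis den1 : forall j, (j <= m.+1)%N -> 1 - a * (y ^+ 3 * q ^+ (6 * j)) != 0.
Hypothesis den2 : forall j, (j <= m)%N -> a - y ^+ 3 * q ^+ (6 * j) != 0.
Hypothesis den3 : forall j, (j <= m)%N -> a * q ^+ 6 - y ^+ 3 * q ^+ (6 * j) != 0.
Hypothesis den4 : forall j, (j <= m)%N ->
  [&& a * q ^+ 5 - y * q ^+ (2 * j) != 0, a * q ^+ 3 - y * q ^+ (2 * j) != 0
    & a * q - y * q ^+ (2 * j) != 0].
Hypothesis den5 : forall j, (j < m)%N ->
  (1 - (y * q ^+ (2 * j)) ^+ 2 * q ^+ 2 != 0) && (1 - (y * q ^+ (2 * j)) ^+ 2 * q ^+ 4 != 0).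

Lemma xsucc k : y * q ^+ (2 * k.+1) = y * q ^+ (2 * k) * q ^+ 2.
Proof. by rewrite -mulrA -exprD; congr (_ * _ ^+ _); lia. Qed.

(** Shifting a by a factor q^6 shifts the products by three steps in base q^2 and
    by one step in base q^6, so the ratio of the two values is rational in x.  The
    constant of proportionality comes from k = 0, which is where y = 1 or y = q
    is needed. *)
Lemma quad_ratio_shift k (x := y * q ^+ (2 * k)) : (k <= m)%N ->
  (a * q ^+ 6 - 1) * (a * q ^+ 5 - x) * (a * q ^+ 3 - x) * (a * q - x)
    * (1 - a * x ^+ 3 * q ^+ 6) * quad_ratio (a * q ^+ 6) k
  = (a - 1) * (1 - a * x * q) * (1 - a * x * q ^+ 3) * (1 - a * x * q ^+ 5)
    * (a - x ^+ 3) * quad_ratio a k.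
Proof.
rewrite {}/x.
elim: k => [|k IHk] lekm.
  rewrite /quad_ratio !big_nat1 !big_geq // muln0 !expr0 !mulr1 /quad.
  have := den1 (leq0n _); have := den1 (ltn0Sn m); have := den2 (leq0n _); have := den3 (leq0n _).
  rewrite muln1 !muln0 !expr0 !mulr1 => h3 h2 h1 h0.
  case: yP => yE; rewrite yE ?expr1n ?mulr1 ?mul1r in h0 h1 h2 h3 *; field.
    by rewrite h0 h1 h2 h3.
  by rewrite h0 h2 h3 mulrAC -mulrA h1.
rewrite !quad_ratioS xsucc.
have {IHk} := IHk (ltnW lekm).
have := den1 (leqW (ltnW lekm)); have := den1 (leqW lekm); have := den1 (lekm : k.+2 <= m.+1)%N.
have := den2 (ltnW lekm); have := den2 lekm; rewrite !xcubeS !xcube !xsucc.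
set x := y * q ^+ (2 * k) => h5 h4 h3 h2 h1.
set w := quad_ratio a k; set w' := quad_ratio _ k => E.
have e1 : a * q ^+ 6 - x ^+ 3 * q ^+ 6 != 0 by rewrite -mulrBl mulf_neq0 ?expf_neq0.
(* K is the common factor by which both sides grow from k to k + 1. *)
pose K := (a - x * q) * (1 - a * q ^+ 7 * x) / ((a - x ^+ 3) * (1 - a * x ^+ 3 * q ^+ 6)).
transitivity ((a * q ^+ 6 - 1) * (a * q ^+ 5 - x) * (a * q ^+ 3 - x) * (a * q - x)
    * (1 - a * x ^+ 3 * q ^+ 6) * w' * K).
  rewrite /quad /K; field.
  rewrite e1 h4 -(mulrA a (x ^+ 3)) h2 -(mulrA a (q ^+ 6)).
  by rewrite (_ : q ^+ 6 * (x ^+ 3 * q ^+ 6) = (x * q ^+ 2) ^+ 3 * q ^+ 6) ?h3 //; ring.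
rewrite E /quad /K; field.
by rewrite h4 h5 h2.
Qed.

(** Dividing by the general term leaves a polynomial identity in a, q and x. *)
Lemma full_term_certificate k : (k < m)%N ->
  (a - 1) * full_term a k - q ^+ 3 * (a * q ^+ 6 - 1) * full_term (a * q ^+ 6) k
  = certificate k.+1 - certificate k.
Proof.
move=> ltkm; have lekm := ltnW ltkm.
have := quad_ratio_shift lekm; rewrite /full_term /certificate coef_termS quad_ratioS xsucc.
have /and3P[] := den4 lekm; have /and3P[] := den4 ltkm; have /andP[] := den5 ltkm.
have := den1 (leqW lekm); have := den1 (leqW ltkm); have := den2 lekm; have := den2 ltkm.
rewrite !xcubeS !xcube !xsucc.
have -> : y ^+ 4 * q ^+ (8 * k + 1) = (y * q ^+ (2 * k)) ^+ 4 * q.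
  by rewrite exprD mulrA exprMn -exprM; congr (_ * _ ^+ _ * _); lia.
set x := y * q ^+ (2 * k); set w := quad_ratio a k; set w' := quad_ratio _ k; set c := coef_term k.
move=> h1 h2 h3 h4 h5 h6 h7 h8 h9 h10 h11 h12 E.
pose L := (a * q ^+ 5 - x) * (a * q ^+ 3 - x) * (a * q - x) * (1 - a * x ^+ 3 * q ^+ 6).
have L_neq0 : L != 0 by rewrite /L !mulf_neq0 // -mulrA.
have -> : q ^+ 3 * (a * q ^+ 6 - 1) * ((1 - x ^+ 4 * q) * c * w')
  = q ^+ 3 * (1 - x ^+ 4 * q) * c * ((a - 1) * (1 - a * x * q) * (1 - a * x * q ^+ 3) * (1 - a * x * q ^+ 5)
    * (a - x ^+ 3) * w) / L.
  by rewrite -E /L; field; rewrite h10 h11 h12 -mulrA h3.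
rewrite /L /quad; field.
by rewrite h1 h3 h6 h7 h8 h9 h10 h11 h12 ?h5 // exprMn h5.
Qed.

(** The sum of [full_term_certificate] over k telescopes; the lower end of the
    telescope vanishes for both values of y. *)
Lemma full_term_recurrence : certificate m = 0 ->
  (a - 1) * \sum_(0 <= k < m) full_term a k
  = q ^+ 3 * (a * q ^+ 6 - 1) * \sum_(0 <= k < m) full_term (a * q ^+ 6) k.
Proof.
move=> cm0; apply/eqP; rewrite -subr_eq0 !mulr_sumr -sumrB.
rewrite (eq_big_nat _ _ (F2 := fun k => certificate k.+1 - certificate k)); last first.
  by move=> k /full_term_certificate.
rewrite telescope_sumr // cm0 sub0r oppr_eq0 /certificate muln0 expr0 mulr1.
by case: yP => ->; rewrite ?expr1n ?subrr !(mulr0, mul0r).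
Qed.
End Core.

(** * Exact evaluation of the terminating sum *)

Section Terminating.
Variables (F : fieldType) (q : F).
Hypothesis q_neq0 : q != 0.
Hypothesis q_expr_neq1 : forall i, (0 < i)%N -> q ^+ i != 1.

Lemma expq_inj i j : (q ^+ i == q ^+ j) = (i == j).
Proof.
wlog lij : i j / (i <= j)%N.
  by move=> wl; case: (leqP i j) => [|/ltnW] /wl // e; rewrite eq_sym e eq_sym.
apply/idP/idP => [|/eqP-> //].
rewrite -(subnKC lij) exprD -{1}[q ^+ i]mulr1 (inj_eq (mulfI (expf_neq0 i q_neq0))).
case: (j - i)%N => [|d]; first by rewrite addn0.
by rewrite eq_sym (negPf (q_expr_neq1 _)).
Qed.

(** The factor j = (n-1)/2 of the numerator is 1 - q^-n q^n. *)
Lemma quad_ratio_eq0 n k : odd n -> (n < k.*2)%N -> quad_ratio q 1 (q ^- n) k = 0.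
Proof.
move=> on lnk; rewrite /quad_ratio big_mkord.
have lt : (n./2 < k)%N by lia.
rewrite (bigD1 (Ordinal lt)) //= /quad (_ : 2 * n./2 + 1 = n)%N; last by lia.
by rewrite mul1r mulVf ?expf_neq0 // subrr !mul0r.
Qed.

Lemma full_term_sum_trunc n m m' : odd n -> (n < m.*2)%N -> (m <= m')%N ->
  \sum_(0 <= k < m') full_term q 1 (q ^- n) k = \sum_(0 <= k < m) full_term q 1 (q ^- n) k.
Proof.
move=> on lnm lmm; rewrite (big_cat_nat (leq0n m) lmm) /=.
rewrite [X in _ + X]big_nat_cond [X in _ + X]big1 ?addr0 //.
by move=> k /andP[/andP[lmk _] _]; rewrite /full_term quad_ratio_eq0 ?mulr0 //; lia.
Qed.

Definition terminating_value (n : nat) : F :=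
  q ^- ((n - 1) %/ 2) * (1 - q ^+ n) * (legendre_m3 n)%:~R.

(** The recurrence at a = q^-(n+6), for which a q^6 = q^-n. *)
Lemma terminating_step n m : odd n -> (n + 6 < m.*2)%N ->
  quad (q ^- n) 1 * \sum_(0 <= k < m) full_term q 1 (q ^- n) k = terminating_value n ->
  quad (q ^- (n + 6)) 1 * \sum_(0 <= k < m) full_term q 1 (q ^- (n + 6)) k
    = terminating_value (n + 6).
Proof.
move=> on lnm; set a := q ^- (n + 6).
have aE : q ^- n = a * q ^+ 6.
  by rewrite /a exprD invfM -mulrA mulVf ?mulr1 ?expf_neq0.
have aq i j : (a * q ^+ i == q ^+ j) = (i == j + (n + 6))%N.
  rewrite -expq_inj exprD -(inj_eq (mulIf (expf_neq0 (n + 6) q_neq0))).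
  by rewrite mulrAC mulVf ?expf_neq0 // mul1r.
have rec : (a - 1) * \sum_(0 <= k < m) full_term q 1 a k
  = q ^+ 3 * (a * q ^+ 6 - 1) * \sum_(0 <= k < m) full_term q 1 (a * q ^+ 6) k.
  apply: full_term_recurrence => //; first by left.
  - move=> j _; rewrite expr1n mul1r subr_eq0 eq_sym; have := aq (6 * j)%N 0%N.
    by rewrite expr0 => ->; lia.
  - move=> j _; rewrite expr1n mul1r subr_eq0; have := aq 0%N (6 * j)%N.
    by rewrite expr0 mulr1 => ->; lia.
  - by move=> j _; rewrite expr1n mul1r subr_eq0 aq; lia.
  - move=> j _; rewrite !mul1r !subr_eq0 !aq -[in a * q](expr1 q) aq.
    by apply/and3P; split; lia.
  - move=> j _; rewrite !mul1r -!exprM -!exprD !subr_eq0 !(eq_sym 1).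
    by rewrite !q_expr_neq1 //; lia.
  - by rewrite /certificate quad_ratio_eq0 ?mulr0 ?mul0r //; lia.
rewrite aE => ih.
have -> : quad a 1 * \sum_(0 <= k < m) full_term q 1 a k =
   (1 - a) * ((a - 1) * \sum_(0 <= k < m) full_term q 1 a k) by rewrite /quad; ring.
rewrite rec.
have a6 : 1 - a * q ^+ 6 != 0.
  by rewrite subr_eq0 eq_sym (aq 6%N 0%N); lia.
have -> : (1 - a) * (q ^+ 3 * (a * q ^+ 6 - 1) * \sum_(0 <= k < m) full_term q 1 (a * q ^+ 6) k)
  = (1 - a) * q ^+ 3 / (1 - a * q ^+ 6) *
   (quad (a * q ^+ 6) 1 * \sum_(0 <= k < m) full_term q 1 (a * q ^+ 6) k).
  by rewrite /quad; field.
rewrite ih /terminating_value.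
have -> : legendre_m3 (n + 6) = legendre_m3 n.
  by rewrite /legendre_m3 (_ : (n + 6) %% 3 = n %% 3)%N; last lia.
have -> : ((n + 6 - 1) %/ 2 = (n - 1) %/ 2 + 3)%N by lia.
rewrite /a exprD in a6 *; rewrite exprD.
set Q := q ^+ n in a6 *; set H := q ^+ (_ %/ 2).
have Q0 : Q != 0 by rewrite expf_neq0.
have Q1 : Q != 1 by rewrite q_expr_neq1 //; lia.
field.
by rewrite q_neq0 Q0 subr_eq0 Q1 expf_neq0.
Qed.

(** Induction in steps of 6 from n = 1, where one term survives, and n = 5, where
    three do. *)
Lemma terminating n m : coprime n 6 -> (n < m.*2)%N ->
  quad (q ^- n) 1 * \sum_(0 <= k < m) full_term q 1 (q ^- n) k = terminating_value n.
Proof.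
move=> co; have on := coprime6_odd co.
have co3 : (n %% 3 != 0)%N.
  by have := coprime6_coprime3 co; rewrite coprime_sym prime_coprime.
have : (n = 6 * (n %/ 6) + 1 \/ n = 6 * (n %/ 6) + 5)%N by lia.
move: (n %/ 6)%N => t; clear co.
elim: t n m on co3 => [|t IHt] n m on co3 nE lnm; last first.
  have -> : n = (n - 6 + 6)%N by lia.
  by apply: terminating_step; [lia | lia | apply: IHt; lia].
have q1 i : (0 < i)%N -> 1 - q ^+ i != 0 by move=> /q_expr_neq1; rewrite subr_eq0 eq_sym.
have := q1 1%N isT; rewrite expr1 => q11.
case: nE => nE; rewrite {}nE muln0 add0n in lnm *.
  rewrite (full_term_sum_trunc (m := 1)) //; last by lia.
  rewrite /terminating_value /full_term /coef_term /quad_ratio /poch unlock /= /quad.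
  rewrite !muln0 /= !expr0 !expr1 !mulr1 /legendre_m3 /= in lnm *.
  by field; rewrite oner_neq0 q_neq0 mulN1r q11 -opprB oppr_eq0 q11.
rewrite (full_term_sum_trunc (m := 3)) //; last by lia.
rewrite /terminating_value /full_term /coef_term /quad_ratio /poch unlock /=.
rewrite /quad /legendre_m3 /=.
rewrite (_ : 2 * 0 ^ 2 = 0)%N // (_ : 2 * 1 ^ 2 = 2)%N // (_ : 2 * 2 ^ 2 = 8)%N //.
rewrite !muln0 !muln1 !add0n !mul1r !expr1n !expr0 -!exprM !mulr1.
field.
rewrite oner_neq0 q_neq0 !mulNr !mul1r -!exprD -[q * q]expr2 -!exprM.
by rewrite -(opprB 1) oppr_eq0 q11 !q1.
Qed.
End Terminating.

(** * The numerator as a polynomial in the parameter *)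

Section Numer.
Variables (F : fieldType) (q y : F).

(** The summand of the theorem, times 1 - q, with the parameter a restored:
    unlike [full_term], it is defined at a = y = 1. *)
Definition param_term (a : F) (k : nat) : F :=
  (1 - y ^+ 4 * q ^+ (8 * k + 1)) * coef_term q y k
  * ((\prod_(0 <= j < k) quad a (y * q ^+ (2 * j + 1)))
     / \prod_(1 <= j < k.+1) quad a (y ^+ 3 * q ^+ (6 * j))).

Definition quad_poly (u : F) : {poly F} := (1 - u%:P * 'X) * ('X - u%:P).

Definition term_poly (m k : nat) : {poly F} :=
  (\prod_(0 <= j < k) quad_poly (y * q ^+ (2 * j + 1)))
  * \prod_(k.+1 <= j < m) quad_poly (y ^+ 3 * q ^+ (6 * j)).

Definition numer_poly (m : nat) : {poly F} :=
  \sum_(0 <= k < m) ((1 - y ^+ 4 * q ^+ (8 * k + 1)) * coef_term q y k) *: term_poly m k.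

Definition denom_poly (m : nat) : {poly F} :=
  \prod_(1 <= j < m) quad_poly (y ^+ 3 * q ^+ (6 * j)).

Lemma horner_quad_poly u a : (quad_poly u).[a] = quad a u.
Proof. by rewrite /quad_poly /quad !hornerE mulrC [a * u]mulrC mulrC. Qed.

Lemma horner_prod_quad_poly (f : nat -> F) i k a :
  (\prod_(i <= j < k) quad_poly (f j)).[a] = \prod_(i <= j < k) quad a (f j).
Proof. by rewrite horner_prod; apply: eq_bigr => j _; rewrite horner_quad_poly. Qed.

Lemma size_prod_quad_poly (f : nat -> F) i k :
  (size (\prod_(i <= j < k) quad_poly (f j))%R <= 2 * (k - i) + 1)%N.
Proof.
elim: k => [|k IHk]; first by rewrite big_geq // size_poly1 sub0n.
have [leik|ltki] := leqP i k; last by rewrite big_geq // size_poly1; lia.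
rewrite big_nat_recr //=; apply: leq_trans (size_polyMleq _ _) _.
have : (size (quad_poly (f k)) <= 3)%N.
  apply: leq_trans (size_polyMleq _ _) _; rewrite size_XsubC addn2 /= ltnS.
  apply: leq_trans (size_polyD _ _) _; rewrite size_polyN geq_max size_poly1 /=.
  by apply: leq_trans (size_polyMleq _ _) _; rewrite size_polyX size_polyC; case: eqP.
move: IHk; set A := size _; set B := size _ => hA hB; lia.
Qed.

(** Each of the m terms is a product of m - 1 quadratic factors. *)
Lemma size_numer_poly m : (0 < m)%N -> (size (numer_poly m) <= 2 * m - 1)%N.
Proof.
move=> m_gt0; rewrite /numer_poly big_mkord; apply: leq_trans (size_sum _ _ _) _.
apply/bigmax_leqP => k _; apply: leq_trans (size_scale_leq _ _) _.
apply: leq_trans (size_polyMleq _ _) _.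
have := size_prod_quad_poly (fun j => y * q ^+ (2 * j + 1)) 0 k.
have := size_prod_quad_poly (fun j => y ^+ 3 * q ^+ (6 * j)) k.+1 m.
by have := ltn_ord k; lia.
Qed.

Lemma horner_numer_poly m a :
  (forall j, (0 < j < m)%N -> quad a (y ^+ 3 * q ^+ (6 * j)) != 0) ->
  (numer_poly m).[a] = (denom_poly m).[a] * \sum_(0 <= k < m) param_term a k.
Proof.
move=> nz; rewrite /numer_poly horner_sum mulr_sumr; apply: eq_big_nat => k /andP[_ ltkm].
rewrite hornerZ hornerM /denom_poly !horner_prod_quad_poly /param_term.
rewrite (big_cat_nat (ltn0Sn k) ltkm) /=.
set A := \prod_(0 <= j < k) _; set B := \prod_(1 <= j < k.+1) _; set C := \prod_(k.+1 <= j < m) _.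
have B0 : B != 0.
  rewrite /B big_nat_cond prodf_seq_neq0; apply/allP => j _; apply/implyP => /andP[/andP[j0 jk] _].
  by apply: nz; rewrite j0 (leq_trans jk).
by field.
Qed.

Lemma param_termE a k : quad a (y ^+ 3) != 0 ->
  param_term a k = quad a (y ^+ 3) * full_term q y a k.
Proof.
move=> nz; rewrite /param_term /full_term /quad_ratio.
rewrite [X in _ = _ * (_ * (_ / X))]big_ltn // muln0 expr0 mulr1 invfM.
by set B := \prod_(1 <= j < k.+1) _; move: (B^-1) => B'; field.
Qed.
End Numer.

(** * Vanishing of the numerator at roots of unity *)

(** An identity between rational functions of a need only be checked away from
    the zeros of some nonzero polynomial: in characteristic 0 a product with too
    many roots is 0. *)
Lemma poly_eq0_off (F : numFieldType) (Z P : {poly F}) : Z != 0 ->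
  (forall a, Z.[a] != 0 -> P.[a] = 0) -> P = 0.
Proof.
move=> Z0 PZ; apply: contraTeq isT => P0 /=.
have PZ0 : P * Z != 0 by rewrite mulf_neq0.
pose s := [seq i%:R | i <- iota 0 (size (P * Z)%R)] : seq F.
have := max_poly_roots (rs := s) PZ0; rewrite size_map size_iota ltnn; apply.
  apply/allP => a _; rewrite /root hornerM.
  by have [->|/PZ ->] := eqVneq Z.[a] 0; rewrite ?mulr0 ?mul0r.
by rewrite map_inj_uniq ?iota_uniq // => i j /eqP; rewrite Num.Theory.eqr_nat => /eqP.
Qed.

Lemma prim_expr_neq (F : fieldType) n (z : F) i j :
  n.-primitive_root z -> (i < j)%N -> (j < i + n)%N -> z ^+ i != z ^+ j.
Proof.
move=> zp lij ljn; rewrite (eq_prim_root_expr zp) eq_sym eqn_mod_dvd ?(ltnW lij) //.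
by apply/negP => /dvdn_leq; lia.
Qed.

Section RootOfUnity.
Variables (n : nat) (F : numFieldType) (q : F).
Hypothesis n_gt3 : (3 < n)%N.
Hypothesis co_n_6 : coprime n 6.
Hypothesis q_prim : n.-primitive_root q.

Let n_odd : odd n := coprime6_odd co_n_6.

Lemma prim2 : n.-primitive_root (q ^+ 2).
Proof. by rewrite prim_root_exp_coprime // coprime2n. Qed.

Lemma prim3 : n.-primitive_root (q ^+ 3).
Proof. by rewrite prim_root_exp_coprime // coprime_sym coprime6_coprime3. Qed.

Lemma prim6 : n.-primitive_root (q ^+ 6).
Proof. by rewrite prim_root_exp_coprime // coprime_sym. Qed.

Lemma prim_root_neq0 : q != 0.
Proof. by rewrite (prim_root_eq0 q_prim); lia. Qed.

(* The two shifts y = 1 and y = q are treated together as y = q^e. *)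
Variable e : bool.
Let y := q ^+ e.
Let m := ((n - 1) %/ 2 - e)%N.
Let u j := y ^+ 3 * q ^+ (6 * j).

(** The numerator (y^2 q; q^2)_(2m) contains the factor 1 - q^n. *)
Lemma coef_term_last : coef_term q y m = 0.
Proof.
have on := n_odd; have e1 := leq_b1 e; rewrite /coef_term /poch.
rewrite [\prod_(0 <= j < 2 * m) (1 - y ^+ 2 * q * _)]big_mkord.
have lt : (m < 2 * m)%N by rewrite /m; lia.
rewrite [\prod_(j < 2 * m) _](bigD1 (Ordinal lt)) //=.
have -> : 1 - y ^+ 2 * q * (q ^+ 2) ^+ m = 0.
  rewrite /y -exprM -exprSr -exprM -exprD.
  by rewrite (_ : (_ + _)%N = n) ?(prim_expr_order q_prim) ?subrr // /m; lia.
by rewrite !(mul0r, mulr0).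
Qed.

Lemma uE j : u j = (q ^+ 3) ^+ (e + 2 * j).
Proof. by rewrite /u /y -!exprM -exprD; congr (q ^+ _); lia. Qed.

Definition full_denom (a : F) k : F := \prod_(0 <= j < k) quad a (u j).

(** Both products shift by one index, so they cancel up to the end factors. *)
Lemma full_denom_shift a k :
  full_denom (a * q ^+ 6) k.+1 * ((1 - a * u 0) * (a - u k))
  = full_denom a k.+1 * ((1 - a * u k.+1) * (a * q ^+ 6 - u 0) * q ^+ (6 * k)).
Proof.
have uS j : u j.+1 = u j * q ^+ 6 by rewrite /u -mulrA -exprD; congr (_ * _ ^+ _); lia.
elim: k => [|k IHk]; rewrite /full_denom.
  by rewrite !big_nat1 /quad uS muln0; ring.
rewrite big_nat_recr //= [in RHS]big_nat_recr //= -/(full_denom _ _) -/(full_denom _ _).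
have -> : full_denom (a * q ^+ 6) k.+1 * quad (a * q ^+ 6) (u k.+1)
    * ((1 - a * u 0) * (a - u k.+1))
  = full_denom (a * q ^+ 6) k.+1 * ((1 - a * u 0) * (a - u k))
    * ((1 - a * u k.+2) * q ^+ 6 * (a - u k.+1)).
  by rewrite /quad !uS; ring.
rewrite IHk (_ : 6 * k.+1 = 6 * k + 6)%N ?exprD /quad ?uS; last by lia.
ring.
Qed.

(** A parameter a with a^n != 1 is generic: every denominator of the recurrence
    that involves a compares a q^i with a power of q. *)
Lemma generic_root (a : F) i : a ^+ n != 1 -> a * q ^+ i != 1.
Proof.
apply: contraNneq => e1; have := congr1 (fun x => x ^+ n) e1.
by rewrite exprMn expr1n -exprM mulnC exprM (prim_expr_order q_prim) expr1n mulr1 => ->.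
Qed.

Lemma generic_root2 (a : F) i j : a ^+ n != 1 -> a * q ^+ i - q ^+ j != 0.
Proof.
apply: contraNneq => /eqP; rewrite subr_eq0 => /eqP e1; have := congr1 (fun x => x ^+ n) e1.
rewrite exprMn -!exprM mulnC exprM (prim_expr_order q_prim) expr1n mulr1 => ->.
by rewrite mulnC exprM (prim_expr_order q_prim) expr1n.
Qed.

Lemma quad_generic (a : F) i : a ^+ n != 1 -> quad a (q ^+ i) != 0.
Proof.
move=> an; rewrite /quad mulf_neq0 //.
  by rewrite subr_eq0 eq_sym generic_root.
by have := @generic_root2 a 0 i an; rewrite mulr1.
Qed.

Lemma recurrence_generic (a : F) : a ^+ n != 1 ->
  (a - 1) * \sum_(0 <= k < m) full_term q y a k
  = q ^+ 3 * (a * q ^+ 6 - 1) * \sum_(0 <= k < m) full_term q y (a * q ^+ 6) k.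
Proof.
move=> an; have on := n_odd; have e1 := leq_b1 e.
apply: full_term_recurrence => //; first exact: prim_root_neq0.
- by rewrite /y; case: (e); [right | left].
- by move=> j _; rewrite /y -exprM -exprD subr_eq0 eq_sym generic_root.
- by move=> j _; rewrite /y -exprM -exprD; have := generic_root2 0 _ an; rewrite expr0 mulr1.
- by move=> j _; rewrite /y -exprM -exprD generic_root2.
- move=> j _; rewrite /y -exprD !generic_root2 // -[in a * q](expr1 q).
  by rewrite generic_root2.
- move=> j ltj; rewrite /y -exprD -!exprM -!exprD !subr_eq0.
  rewrite (_ : (e + 2 * j) * 2 + 2 = 2 * (e + 2 * j + 1))%N; last by lia.
  rewrite (_ : (e + 2 * j) * 2 + 4 = 2 * (e + 2 * j + 2))%N; last by lia.
  rewrite !(exprM q 2) -(expr0 (q ^+ 2)); rewrite /m in ltj.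
  by apply/andP; split; apply: (prim_expr_neq prim2); lia.
by rewrite /certificate coef_term_last !(mulr0, mul0r).
Qed.

(** [recurrence_generic] with denominators cleared.  After cancelling the factors
    common to both sides, which differ for e = 0 and e = 1, this is a polynomial
    identity, so it holds for every a. *)
Lemma numer_poly_recurrence (a : F) :
  (a * q ^+ 6 - 1) ^+ e * (numer_poly q y m).[a * q ^+ 6] * (q ^+ 3) ^+ (~~ e) * (u m.-1 - a)
  = (a - 1) ^+ e * (numer_poly q y m).[a] * (1 - a * u m) * q ^+ (6 * m.-1).
Proof.
pose P1 := ((q ^+ 6) *: 'X - 1) ^+ e * (numer_poly q y m \Po ((q ^+ 6) *: 'X))
  * ((q ^+ 3) ^+ (~~ e))%:P * ((u m.-1)%:P - 'X).
pose P2 := ('X - 1) ^+ e * numer_poly q y m * (1 - (u m) *: 'X)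
  * (q ^+ (6 * m.-1))%:P.
suff: P1 - P2 = 0.
  move=> P12; have := congr1 (fun p => p.[a]) P12; rewrite /= horner0 => h.
  rewrite /P1 /P2 !(hornerE, horner_comp, horner_exp) in h.
  by move/eqP: h; rewrite subr_eq0 [q ^+ 6 * a]mulrC [u m * a]mulrC => /eqP.
apply: (@poly_eq0_off _ ('X^n - 1)) => [|{}a].
  by rewrite -size_poly_gt0 size_XnsubC; lia.
rewrite !hornerE subr_eq0 => an.
rewrite /P1 /P2 !(hornerE, horner_comp, horner_exp) [q ^+ 6 * a]mulrC [u m * a]mulrC.
have an6 : (a * q ^+ 6) ^+ n != 1.
  by rewrite exprMn -exprM mulnC exprM (prim_expr_order q_prim) expr1n mulr1.
have nz b i : b ^+ n != 1 -> full_denom b i != 0.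
  move=> bn; rewrite /full_denom big_mkord prodf_seq_neq0; apply/allP => j _ /=.
  by rewrite uE -exprM quad_generic.
have m_gt0 : (0 < m)%N by have := leq_b1 e; have := n_odd; rewrite /m; lia.
have numE b : b ^+ n != 1 ->
    (numer_poly q y m).[b] = full_denom b m * \sum_(0 <= k < m) full_term q y b k.
  move=> bn; rewrite horner_numer_poly => [|j _]; last first.
    by rewrite -/(u j) uE -exprM quad_generic.
  rewrite /denom_poly horner_prod_quad_poly /full_denom [in RHS]big_ltn //.
  rewrite {1}/u muln0 expr0 mulr1 [quad _ _ * _]mulrC -mulrA; congr (_ * _).
  rewrite mulr_sumr; apply: eq_bigr => k _.
  by rewrite param_termE // /y -exprM quad_generic.
have := recurrence_generic an; have := full_denom_shift a m.-1; rewrite prednK //.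
rewrite !numE //; move: (nz a m an) (nz a 1%N an).
rewrite {2}/full_denom big_nat1 /quad.
have -> : u 0 = (q ^+ 3) ^+ e by rewrite uE addn0.
set U := u m.-1; set U' := u m; set Q6 := q ^+ (6 * _).
move: (full_denom a m) (full_denom (a * q ^+ 6) m) => D D'.
move: (\sum_(0 <= k < m) full_term q y a k) => S.
move: (\sum_(0 <= k < m) full_term q y (a * q ^+ 6) k) => S'.
rewrite {}/U {}/U' {}/Q6; move: (u m.-1) (u m) (q ^+ (6 * _)) => U U' Q6.
case: (e); rewrite /= ?expr0 ?expr1 ?mul1r ?mulr1 => D0;
  rewrite mulf_eq0 negb_or => /andP[d1 d2] ED ES.
  have q3d1 := mulf_neq0 (expf_neq0 3 prim_root_neq0) d1.
  apply/eqP; rewrite subr_eq0 -(inj_eq (mulfI q3d1)); apply/eqP.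
  transitivity (- (q ^+ 3 * (a * q ^+ 6 - 1) * S')
    * (D' * ((1 - a * q ^+ 3) * (a - U)))); first ring.
  by rewrite ED -ES; ring.
apply/eqP; rewrite subr_eq0 -(inj_eq (mulfI d2)); apply/eqP.
transitivity (q ^+ 3 * S' * (D' * ((1 - a) * (a - U)))); first ring.
rewrite ED; transitivity (D * (1 - a * U') * Q6
  * (q ^+ 3 * (a * q ^+ 6 - 1) * S')); first ring.
by rewrite -ES; ring.
Qed.

(** In [numer_poly_recurrence], a = (u m)^-1 kills the right-hand side, so
    z 0 = q^6 / u m is a root, and a root at z i gives one at z i.+1 = z i q^6 as
    long as the left cofactor is nonzero.  The first zero of that cofactor comes
    only after 2m - 1 distinct roots, while the degree is at most 2m - 2. *)
Lemma numer_poly_eq0 : numer_poly q y m = 0.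
Proof.
have on := n_odd; have e1 := leq_b1 e; have mE : m = ((n - 1) %/ 2 - e)%N by [].
have m_gt0 : (0 < m)%N by lia.
(* All the points below are powers of w = q^3, kept abstract. *)
have [w wE] : exists w, w = q ^+ 3 by exists (q ^+ 3).
have wp : n.-primitive_root w by rewrite wE prim3.
have w0 : w != 0 by rewrite wE expf_neq0 ?prim_root_neq0.
have uE j : u j = w ^+ (e + 2 * j) by rewrite uE wE.
pose z i := w ^- (e + 2 * m.-1) * w ^+ (2 * i).
have w2 : q ^+ 6 = w ^+ 2 by rewrite wE -exprM.
have zS i : z i * q ^+ 6 = z i.+1.
  by rewrite w2 /z -mulrA -exprD (_ : 2 * i + 2 = 2 * i.+1)%N //; lia.
have z_inj i j : (i < j)%N -> (j < n)%N -> z i != z j.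
  move=> ij jn; rewrite (inj_eq (mulfI (invr_neq0 (expf_neq0 (e + 2 * m.-1) w0)))).
  by rewrite 2!(exprM w 2) -w2; apply: (prim_expr_neq prim6) => //; lia.
have zw i j : (z i == w ^+ j) = (w ^+ (2 * i) == w ^+ (j + (e + 2 * m.-1))).
  rewrite -(inj_eq (mulfI (expf_neq0 (e + 2 * m.-1) w0))) (mulVKf (expf_neq0 _ w0)).
  by rewrite -exprD addnC.
have wneq i j : i != j -> (i < j + n)%N -> (j < i + n)%N -> w ^+ i != w ^+ j.
  by case: (ltngtP i j) => // ij _ h1 h2; [|rewrite eq_sym]; apply: (prim_expr_neq wp).
have zneq1 i : e -> (i <= 2 * m - 2)%N -> (z i - 1 == 0) = false.
  by move=> et lti; apply/negbTE; rewrite subr_eq0 -(expr0 w) zw wneq //; lia.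
have zroot : forall i, (i < 2 * m - 1)%N -> (numer_poly q y m).[z i] = 0.
  elim => [|i IHi] lti.
    have := numer_poly_recurrence (w ^- (e + 2 * m)).
    have -> : w ^- (e + 2 * m) * q ^+ 6 = z 0%N.
      rewrite /z muln0 mulr1 w2 (_ : e + 2 * m = e + 2 * m.-1 + 2)%N; last by lia.
      by rewrite exprD invfM mulfVK ?(expf_neq0 2 w0).
    have -> : 1 - w ^- (e + 2 * m) * u m = 0 by rewrite uE mulVf ?subrr ?expf_neq0.
    rewrite mulr0 mul0r => /eqP; rewrite !mulf_eq0 !expf_eq0.
    rewrite (negPf prim_root_neq0) !andbF !orbF.
    have -> : (0 < e)%N && (z 0%N - 1 == 0) = false.
      by case et: (e) => //=; rewrite zneq1.
    rewrite /= => /orP[/eqP //|].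
    rewrite subr_eq0 uE -(inj_eq (mulIf (expf_neq0 (e + 2 * m) w0))) mulVf ?expf_neq0 //.
    rewrite -exprD -(prim_expr_order wp) (negPf (wneq _ _ _ _ _)) //; lia.
  have := numer_poly_recurrence (z i); rewrite IHi ?zS; last by lia.
  rewrite mulr0 !mul0r => /eqP; rewrite !mulf_eq0 !expf_eq0.
  rewrite (negPf prim_root_neq0) !andbF !orbF.
  have -> : (0 < e)%N && (z i.+1 - 1 == 0) = false.
    by case et: (e) => //=; rewrite zneq1 //; lia.
  rewrite /= => /orP[/eqP //|].
  rewrite subr_eq0 eq_sym uE zw addnn -mul2n !(exprM w 2) -w2.
  by rewrite (negPf (prim_expr_neq prim6 _ _)) //; lia.
apply/eqP; apply: contraT => /max_poly_roots P0.
have := P0 [seq z i | i <- iota 0 (2 * m - 1)].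
rewrite size_map size_iota ltnNge size_numer_poly //; apply.
  apply/allP => x /mapP[i]; rewrite mem_iota add0n => /andP[_ lti] ->.
  by rewrite /root zroot.
rewrite map_inj_in_uniq ?iota_uniq // => i j.
rewrite !mem_iota !add0n => /andP[_ lti] /andP[_ ltj] zz.
by case: (ltngtP i j) => // ij; [have := z_inj i j ij | have := z_inj j i ij];
   rewrite zz eqxx => h; have := h ltac:(lia).
Qed.
End RootOfUnity.

(** * The family at a = 1 *)

Section AtOne.
Variables (F : fieldType).
Implicit Types q y : F.

Definition unit_term q y (k : nat) : F :=
  (1 - y ^+ 4 * q ^+ (8 * k + 1)) * coef_term q y k
  * (poch (y * q) (q ^+ 2) k / poch (y ^+ 3 * q ^+ 6) (q ^+ 6) k) ^+ 2.

Lemma param_term_at1 q y k : param_term q y 1 k = unit_term q y k.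
Proof.
rewrite /param_term /unit_term; congr (_ * _); rewrite expr_div_n.
congr (_ / _); rewrite /poch expr2 -big_split /=; last rewrite big_add1 /=.
  apply: eq_bigr => j _; rewrite /quad mul1r -exprM exprD expr1 [q ^+ _ * q]mulrC mulrA //.
apply: eq_bigr => j _; rewrite /quad mul1r -exprM -mulrA -exprD.
by rewrite (_ : 6 + 6 * j = 6 * j.+1)%N //; lia.
Qed.

Lemma pochD (x p : F) i k : poch x p (i + k) = poch x p i * poch (x * p ^+ i) p k.
Proof.
rewrite /poch (big_cat_nat (leq0n i) (leq_addr k i)) /=; congr (_ * _).
rewrite -{1}[i]add0n big_addn addKn; apply: eq_bigr => j _.
by rewrite addnC exprD mulrA.
Qed.

(** The part of the term of index s that can be taken out of every later term. *)
Definition unit_prefactor q (s : nat) : F :=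
  poch q (q ^+ 2) (2 * s) / poch (q ^+ 2) (q ^+ 2) (2 * s) * q ^+ (2 * s ^ 2)
  * (poch q (q ^+ 2) s / poch (q ^+ 6) (q ^+ 6) s) ^+ 2.

(** Starting the summation at s instead of 0 amounts to the shift y = q^(2s). *)
Lemma unit_term_split q s k :
  unit_term q 1 (s + k) = unit_prefactor q s * unit_term q (q ^+ (2 * s)) k.
Proof.
rewrite /unit_term /unit_prefactor /coef_term !expr1n !mul1r !mulr1.
rewrite (_ : 2 * (s + k) = 2 * s + 2 * k)%N; last by lia.
rewrite !(pochD _ _ s k) !(pochD _ _ (2 * s) (2 * k)) -!exprM.
rewrite (_ : q ^+ (2 * s * 4) * q ^+ (8 * k + 1) = q ^+ (8 * (s + k) + 1)); last first.
  by rewrite -exprD; congr (q ^+ _); lia.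
rewrite (_ : q ^+ (2 * (s + k) ^ 2)
    = q ^+ (2 * s ^ 2) * q ^+ (2 * k ^ 2) * q ^+ (2 * s * (2 * k))); last first.
  by rewrite -!exprD; congr (q ^+ _); lia.
rewrite (_ : q ^+ (2 * s * 2) * q = q * q ^+ (2 * (2 * s))); last first.
  by rewrite -exprSr -exprS; congr (q ^+ _); lia.
rewrite (_ : q ^+ (2 * s * 2) * q ^+ 2 = q ^+ 2 * q ^+ (2 * (2 * s))); last first.
  by rewrite -!exprD; congr (q ^+ _); lia.
rewrite (_ : q ^+ (2 * s) * q = q * q ^+ (2 * s)); last by rewrite mulrC.
rewrite (_ : q ^+ (2 * s * 3) * q ^+ 6 = q ^+ 6 * q ^+ (6 * s)); last first.
  by rewrite -!exprD; congr (q ^+ _); lia.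
do 4!move: (poch _ _ _ : F) => ?.
do 4!move: (poch _ _ _ : F) => ?.
rewrite !invfM; ring.
Qed.
End AtOne.

Section AtOneRootOfUnity.
Variables (n : nat) (F : numFieldType) (q : F).
Hypothesis n_gt3 : (3 < n)%N.
Hypothesis co_n_6 : coprime n 6.
Hypothesis q_prim : n.-primitive_root q.
Variable e : bool.

Lemma poch_cden_neq0 k : (k <= (n - 1) %/ 2 - e)%N ->
  poch ((q ^+ e) ^+ 2 * q ^+ 2) (q ^+ 2) (2 * k) != 0.
Proof.
move=> lek; rewrite /poch big_mkord prodf_seq_neq0; apply/allP => j _ /=.
have on := coprime6_odd co_n_6; have e1 := leq_b1 e; have := ltn_ord j => ltj.
rewrite subr_eq0 -!exprM -!exprD (_ : _ + _ = 2 * (e + 1 + j))%N; last by lia.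
by rewrite exprM -(expr0 (q ^+ 2)) (prim_expr_neq (prim2 co_n_6 q_prim)) //; lia.
Qed.

Lemma poch_gden_neq0 k : (k <= (n - 1) %/ 2 - e)%N ->
  poch ((q ^+ e) ^+ 3 * q ^+ 6) (q ^+ 6) k != 0.
Proof.
move=> lek; rewrite /poch big_mkord prodf_seq_neq0; apply/allP => j _ /=.
have on := coprime6_odd co_n_6; have e1 := leq_b1 e; have := ltn_ord j => ltj.
rewrite subr_eq0 -!exprM -!exprD (_ : _ + _ = 3 * (e + 2 * (1 + j)))%N; last by lia.
by rewrite exprM -(expr0 (q ^+ 3)) (prim_expr_neq (prim3 co_n_6 q_prim)) //; lia.
Qed.

Lemma unit_term_sum_eq0 : \sum_(0 <= k < ((n - 1) %/ 2 - e).+1) unit_term q (q ^+ e) k = 0.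
Proof.
rewrite big_nat_recr //= [X in _ + X]/unit_term.
rewrite (coef_term_last n_gt3 co_n_6 q_prim) mulr0 mul0r addr0.
have on := coprime6_odd co_n_6; have e1 := leq_b1 e.
set m := ((n - 1) %/ 2 - e)%N.
have nz j : (0 < j < m)%N -> quad 1 ((q ^+ e) ^+ 3 * q ^+ (6 * j)) != 0.
  rewrite /m => ltj; have h : 1 - (q ^+ e) ^+ 3 * q ^+ (6 * j) != 0.
    rewrite subr_eq0 -!exprM -!exprD (_ : _ + _ = 3 * (e + 2 * j))%N; last by lia.
    by rewrite exprM -(expr0 (q ^+ 3)) (prim_expr_neq (prim3 co_n_6 q_prim)) //; lia.
  by rewrite /quad mul1r mulf_neq0.
have := horner_numer_poly (m := m) nz; rewrite (numer_poly_eq0 n_gt3 co_n_6 q_prim) horner0.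
move/esym/eqP; rewrite mulf_eq0 /denom_poly horner_prod_quad_poly => /orP[|/eqP].
  rewrite big_nat_cond prodf_seq_eq0 => /hasP[j _ /andP[/andP[jm _]]].
  by rewrite (negPf (nz j jm)).
by move=> S0; rewrite -[RHS]S0; apply: eq_bigr => k _; rewrite param_term_at1.
Qed.
End AtOneRootOfUnity.

(** * Specialisation of rational functions at an algebraic number *)

Lemma ratfun_eq0 (U : Zq) : (ratfun U == 0) = (U == 0).
Proof. exact: tofrac_eq0. Qed.

Lemma ratfunM (U V : Zq) : ratfun (U * V) = ratfun U * ratfun V.
Proof. exact: tofracM. Qed.

Lemma ratfunD (U V : Zq) : ratfun (U + V) = ratfun U + ratfun V.
Proof. exact: tofracD. Qed.

Lemma ratfunN (U : Zq) : ratfun (- U) = - ratfun U.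
Proof. exact: tofracN. Qed.

Lemma ratfun1 : ratfun 1 = 1. Proof. exact: tofrac1. Qed.

Lemma ratfunX (U : Zq) k : ratfun (U ^+ k) = ratfun U ^+ k.
Proof. exact: tofracXn. Qed.

Lemma qX k : q ^+ k = ratfun ('X ^+ k).
Proof. by rewrite ratfunX. Qed.

Lemma q_neq0 : q != 0.
Proof. by rewrite ratfun_eq0 polyX_eq0. Qed.

Lemma q_expr_neq1 i : (0 < i)%N -> q ^+ i != 1.
Proof.
move=> i_gt0; rewrite qX -ratfun1 -subr_eq0 -ratfunN -ratfunD ratfun_eq0.
by rewrite -size_poly_gt0 size_XnsubC.
Qed.

Section Representatives.
Local Open Scope quotient_scope.

Lemma ratfunP (x : Qq) : exists U V : Zq, V != 0 /\ x = ratfun U / ratfun V.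
Proof.
elim/quotW: x => r; exists (\n_r), (\d_r); split; first exact: denom_ratioP.
rewrite /ratfun; change (\pi_Qq r = FracField.mul (FracField.tofrac \n_r)
  (FracField.inv (FracField.tofrac \d_r))).
rewrite !piE; apply/eqP; rewrite piE /= /FracField.equivf /= /FracField.mulf /FracField.invf.
by rewrite !numden_Ratio ?oner_neq0 ?mul1r ?mulr1 ?denom_ratioP // mulrC.
Qed.
End Representatives.

Section Specialization.
Variable z : algC.

Definition zeval (U : Zq) : algC := (map_poly intr U).[z].

(** The local ring of rational functions without pole at z and its evaluation map,
    as a relation: a summand may be regular at z although some of its factors are
    not. *)
Definition ev (x : Qq) (c : algC) : Prop :=
  exists U V : Zq, [/\ zeval V != 0, x = ratfun U / ratfun V & c = zeval U / zeval V].

Lemma zevalM U V : zeval (U * V) = zeval U * zeval V.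
Proof. by rewrite /zeval rmorphM hornerM. Qed.
Lemma zevalD U V : zeval (U + V) = zeval U + zeval V.
Proof. by rewrite /zeval rmorphD hornerD. Qed.
Lemma zevalN U : zeval (- U) = - zeval U.
Proof. by rewrite /zeval rmorphN hornerN. Qed.
Lemma zeval1 : zeval 1 = 1.
Proof. by rewrite /zeval rmorph1 hornerC. Qed.

Lemma zeval_neq0 V : zeval V != 0 -> ratfun V != 0.
Proof. by rewrite ratfun_eq0; apply: contra_neq => ->; rewrite /zeval rmorph0 horner0. Qed.

Lemma ev_ratfun U : ev (ratfun U) (zeval U).
Proof. by exists U, 1; rewrite zeval1 ratfun1 !divr1 oner_neq0. Qed.

Lemma ev1 : ev 1 1.
Proof. by have := ev_ratfun 1; rewrite ratfun1 zeval1. Qed.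

Lemma evq : ev q z.
Proof. by have := ev_ratfun 'X; rewrite /zeval map_polyX hornerX. Qed.

Lemma evD x c y d : ev x c -> ev y d -> ev (x + y) (c + d).
Proof.
move=> [U [V [V0 -> ->]]] [U' [V' [V'0 -> ->]]].
exists (U * V' + U' * V), (V * V'); rewrite !zevalM zevalD !zevalM mulf_neq0 //.
rewrite ratfunD !ratfunM; split=> //; first by rewrite addf_div ?zeval_neq0.
by rewrite addf_div.
Qed.

Lemma evM x c y d : ev x c -> ev y d -> ev (x * y) (c * d).
Proof.
move=> [U [V [V0 -> ->]]] [U' [V' [V'0 -> ->]]].
by exists (U * U'), (V * V'); rewrite !zevalM mulf_neq0 // !ratfunM !mulf_div.
Qed.

Lemma evN x c : ev x c -> ev (- x) (- c).
Proof.
move=> [U [V [V0 -> ->]]]; exists (- U), V.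
by rewrite zevalN ratfunN !mulNr.
Qed.

Lemma evB x c y d : ev x c -> ev y d -> ev (x - y) (c - d).
Proof. by move=> hx /evN; apply: evD. Qed.

Lemma ev0 : ev 0 0.
Proof. by have := evB ev1 ev1; rewrite !subrr. Qed.

Lemma evV x c : ev x c -> c != 0 -> ev x^-1 c^-1.
Proof.
move=> [U [V [V0 -> ->]]]; rewrite mulf_eq0 negb_or => /andP[U0 _].
by exists V, U; rewrite !invf_div.
Qed.

Lemma ev_div x c y d : ev x c -> ev y d -> d != 0 -> ev (x / y) (c / d).
Proof. by move=> hx hy d0; apply: evM hx (evV hy d0). Qed.

Lemma evX x c k : ev x c -> ev (x ^+ k) (c ^+ k).
Proof.
by move=> hx; elim: k => [|k IHk]; rewrite ?expr0 ?exprS; [exact: ev1 | exact: evM].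
Qed.

Lemma ev_sum (f : nat -> Qq) (g : nat -> algC) i k :
  (forall j, (i <= j < k)%N -> ev (f j) (g j)) ->
  ev (\sum_(i <= j < k) f j) (\sum_(i <= j < k) g j).
Proof.
move=> fg; rewrite big_nat [X in ev _ X]big_nat.
by apply: (big_ind2 ev) => //; [exact: ev0 | exact: evD].
Qed.

Lemma ev_prod (f : nat -> Qq) (g : nat -> algC) i k :
  (forall j, (i <= j < k)%N -> ev (f j) (g j)) ->
  ev (\prod_(i <= j < k) f j) (\prod_(i <= j < k) g j).
Proof.
move=> fg; rewrite big_nat [X in ev _ X]big_nat.
by apply: (big_ind2 ev) => //; [exact: ev1 | exact: evM].
Qed.

Lemma ev_int (i : int) : ev i%:~R i%:~R.
Proof.
have evn k : ev k%:R k%:R.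
  by elim: k => [|k IHk]; [exact: ev0 | rewrite !mulrS; exact: evD ev1 IHk].
by case: i => k; [exact: evn | rewrite NegzE !mulrNz; exact: (evN (evn _))].
Qed.

Lemma ev_poch x c y d k : ev x c -> ev y d -> ev (poch x y k) (poch c d k).
Proof.
move=> hx hy; apply: ev_prod => j _; apply: evB ev1 _.
by apply: evM => //; apply: evX.
Qed.

Lemma ev_coef_term y d k : ev y d -> poch (d ^+ 2 * z ^+ 2) (z ^+ 2) (2 * k) != 0 ->
  ev (coef_term q y k) (coef_term z d k).
Proof.
move=> hy nz; have hq := evq; rewrite /coef_term.
apply: evM; last exact: evX.
apply: evM; last exact: evX.
apply: ev_div nz; apply: ev_poch; try exact: evX.
  by apply: evM => //; apply: evX.
by apply: evM; apply: evX.
Qed.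

Lemma ev_unit_term y d k : ev y d -> poch (d ^+ 2 * z ^+ 2) (z ^+ 2) (2 * k) != 0 ->
  poch (d ^+ 3 * z ^+ 6) (z ^+ 6) k != 0 -> ev (unit_term q y k) (unit_term z d k).
Proof.
move=> hy nz nz'; have hq := evq; rewrite /unit_term.
apply: evM; last first.
  apply: evX; apply: ev_div nz'; apply: ev_poch; try exact: evX.
    exact: evM.
  by apply: evM; apply: evX.
apply: evM; last exact: ev_coef_term.
by apply: evB ev1 _; apply: evM; apply: evX.
Qed.

Lemma ev_terminating_value n d : (0 < n)%N -> (d %| n)%N -> d.-primitive_root z ->
  ev (terminating_value q n) 0.
Proof.
move=> n_gt0 dn zp; have hq := evq.
have -> : 0 = z ^- ((n - 1) %/ 2) * (1 - z ^+ n) * (legendre_m3 n)%:~R.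
  by move: dn; rewrite (prim_order_dvd zp) => /eqP->; rewrite subrr mulr0 mul0r.
apply: evM (ev_int _); apply: evM; last exact: evB ev1 (evX _ hq).
apply: evV (evX _ hq) _; rewrite expf_neq0 // (prim_root_eq0 zp).
by have := dvdn_gt0 n_gt0 dn; lia.
Qed.
End Specialization.

(** * Orders at a root of unity *)

Section Cyclo.
Variables (n : nat) (z : algC).
Hypothesis z_prim : n.-primitive_root z.

Lemma zeval_Phi : zeval z 'Phi_n = 0.
Proof.
apply/eqP; rewrite /zeval (Cintr_Cyclotomic z_prim) -/(root _ _).
by rewrite root_cyclotomic.
Qed.

(** The cyclotomic polynomial is the minimal polynomial of z and is monic, so the
    division takes place in Z[q]. *)
Lemma zeval_eq0 U : zeval z U = 0 -> exists U', U = U' * 'Phi_n.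
Proof.
move=> Uz; have [p [Dp _] dv_p] := minCpolyP z.
have ZtoC (V : Zq) : map_poly intr V = map_poly ratr (map_poly intr V : {poly rat}) :> {poly algC}.
  by rewrite -map_poly_comp; apply: eq_map_poly => b; rewrite /= rmorph_int.
have Phi_p : map_poly intr 'Phi_n = p.
  apply: (map_inj_poly (fmorph_inj (@ratr algC)) (rmorph0 _)).
  by rewrite -Dp -ZtoC (Cintr_Cyclotomic z_prim) (minCpoly_cyclotomic z_prim).
have : root (map_poly ratr (map_poly intr U : {poly rat})) z by rewrite -ZtoC; apply/eqP.
rewrite dv_p -Phi_p dvdp_rat_int => /dvdpP_int[r ->]; exists r.
by rewrite zprimitive_monic ?Cyclotomic_monic // mulrC.
Qed.
End Cyclo.

(** A common factor has a root, which is again a primitive n-th root of unity, so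
    that V would vanish at all of them. *)
Lemma coprimep_Phi n z V : n.-primitive_root z -> zeval z V != 0 -> coprimep 'Phi_n V.
Proof.
move=> zp Vz; apply: contraT => ncop.
set g := zprimitive (gcdp 'Phi_n V).
have [[r Er] [s Es]] := (dvdpP_int (dvdp_gcdl 'Phi_n V), dvdpP_int (dvdp_gcdr 'Phi_n V)).
have /closed_rootP[x gx] : size (map_poly intr g : {poly algC}) != 1%N.
  by rewrite size_map_inj_poly ?rmorph0 //; [rewrite size_zprimitive | exact: intr_inj].
have gx0 : zeval x g = 0 by apply/eqP.
have xp : n.-primitive_root x.
  rewrite -(root_cyclotomic zp) -(Cintr_Cyclotomic zp); apply/eqP.
  by rewrite -/(zeval x 'Phi_n) Er zevalM gx0 mul0r.
have [V' EV] : exists V', V = V' * 'Phi_n.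
  by apply: (zeval_eq0 xp); rewrite Es zevalM gx0 mul0r.
by move: Vz; rewrite EV zevalM (zeval_Phi zp) mulr0 eqxx.
Qed.

Section Order.
Variables (n : nat) (z : algC).
Hypothesis z_prim : n.-primitive_root z.
Let n_gt0 : (0 < n)%N := prim_order_gt0 z_prim.

(** 1 - q^n generates the same ideal as 'Phi_n in the local ring at z, and orders
    of 1 - q^m are easier to compute with it. *)
Definition uniformizer : Qq := 1 - q ^+ n.

Definition order_eq (e : int) (x : Qq) : Prop :=
  exists y c, [/\ x = uniformizer ^ e * y, ev z y c & c != 0].
Definition order_ge (e : nat) (x : Qq) : Prop :=
  exists y c, x = uniformizer ^+ e * y /\ ev z y c.

Lemma uniformizer_neq0 : uniformizer != 0.
Proof. by rewrite subr_eq0 eq_sym q_expr_neq1. Qed.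

Lemma ev_uniformizer : ev z uniformizer 0.
Proof.
by have := evB (ev1 z) (evX n (evq z)); rewrite (prim_expr_order z_prim) subrr.
Qed.

Lemma order_eq0 x c : ev z x c -> c != 0 -> order_eq 0 x.
Proof. by exists x, c; rewrite expr0z mul1r. Qed.

Lemma order_eqM e x f y : order_eq e x -> order_eq f y -> order_eq (e + f) (x * y).
Proof.
move=> [x' [c [-> hx c0]]] [y' [d [-> hy d0]]]; exists (x' * y'), (c * d).
by rewrite mulf_neq0 // expfzDr ?uniformizer_neq0 // mulrACA; split=> //; apply: evM.
Qed.

Lemma order_eqV e x : order_eq e x -> order_eq (- e) x^-1.
Proof.
move=> [x' [c [-> hx c0]]]; exists x'^-1, c^-1.
by rewrite invr_eq0 c0 invfM -invr_expz; split=> //; apply: evV.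
Qed.

(** If m = n k then 1 - q^m is (1 - q^n) times a sum of k powers of q^n, which
    takes the nonzero value k at z. *)
Lemma order_eq_1subXn m : (0 < m)%N -> order_eq (n %| m)%:Z (1 - q ^+ m).
Proof.
move=> m_gt0; have [/dvdnP[k mk]|ndv] := boolP (n %| m)%N.
  exists (\sum_(0 <= i < k) (q ^+ n) ^+ i), k%:R; split.
  - rewrite mk mulnC exprM -[1 - _ ^+ k]opprB subrX1 big_mkord -mulNr opprB.
    by rewrite /uniformizer expr1z.
  - have -> : k%:R = \sum_(0 <= i < k) (z ^+ n) ^+ i :> algC.
      rewrite (prim_expr_order z_prim) (eq_bigr (fun=> 1)) => [|i _]; last by rewrite expr1n.
      by rewrite sumr_const_nat subn0.
    by apply: ev_sum => i _; do 2!apply: evX; apply: evq.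
  - by rewrite Num.Theory.pnatr_eq0; apply: contraTneq m_gt0 => k0; rewrite mk k0.
apply: (@order_eq0 _ (1 - z ^+ m)).
  by apply: evB (ev1 z) _; apply: evX; apply: evq.
by rewrite subr_eq0 eq_sym -(prim_order_dvd z_prim).
Qed.

Lemma order_eq_poch s t k : (0 < s)%N ->
  order_eq (\sum_(0 <= j < k) (n %| s + t * j))%N (poch (q ^+ s) (q ^+ t) k).
Proof.
move=> s_gt0; elim: k => [|k IHk].
  by rewrite /poch !big_geq //; apply: order_eq0 (ev1 z) (oner_neq0 _).
rewrite pochS big_nat_recr //= PoszD; apply: order_eqM => //.
by rewrite -exprM -exprD; apply: order_eq_1subXn; rewrite addn_gt0 s_gt0.
Qed.

Lemma order_ge0 x c : ev z x c -> order_ge 0 x.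
Proof. by exists x, c; rewrite mul1r. Qed.

Lemma order_ge0_ev x : order_ge 0 x -> exists c, ev z x c.
Proof. by move=> [y [c [-> hy]]]; exists c; rewrite mul1r. Qed.

Lemma order_ge_gt0 e x : (0 < e)%N -> order_ge e x -> ev z x 0.
Proof.
case: e => // e _ [y [c [-> hy]]].
by have := evM (evM ev_uniformizer (evX e ev_uniformizer)) hy; rewrite !mul0r exprS.
Qed.

Lemma order_geM e x f y : order_ge e x -> order_ge f y -> order_ge (e + f) (x * y).
Proof.
move=> [x' [c [-> hx]]] [y' [d [-> hy]]]; exists (x' * y'), (c * d).
by rewrite exprD mulrACA; split=> //; apply: evM.
Qed.

Lemma order_geD e x y : order_ge e x -> order_ge e y -> order_ge e (x + y).
Proof.
move=> [x' [c [-> hx]]] [y' [d [-> hy]]]; exists (x' + y'), (c + d).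
by rewrite mulrDr; split=> //; apply: evD.
Qed.

Lemma order_eq_ge (e : int) (f : nat) x : (f%:Z <= e)%R -> order_eq e x -> order_ge f x.
Proof.
move=> fe [y [c [-> hy _]]]; have [k ->] : exists k : nat, e = (f + k)%N%:Z.
  by exists `|e - f%:Z|%N; lia.
exists (uniformizer ^+ k * y), (0 ^+ k * c); rewrite -exprnP exprD mulrA; split=> //.
by apply: evM => //; apply: evX; exact: ev_uniformizer.
Qed.

(** The cofactor W of 'Phi_n in X^n - 1 is nonzero at z, since X^n - 1 has simple
    roots; so 'Phi_n and 1 - q^n are associated. *)
Lemma ev0_order_ge1 x : ev z x 0 -> order_ge 1 x.
Proof.
move=> [U [V [V0 -> /esym/eqP]]]; rewrite mulf_eq0 invr_eq0 (negPf V0) orbF => /eqP U0.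
have [U' EU] := zeval_eq0 z_prim U0.
have [W EW] : exists W, 'X^n - 1 = W * 'Phi_n.
  apply: (zeval_eq0 z_prim); rewrite /zeval rmorphB /= map_polyXn rmorph1 !hornerE.
  by rewrite (prim_expr_order z_prim) subrr.
have W0 : zeval z W != 0.
  have := congr1 (fun p : Zq => zeval z p^`()) EW.
  rewrite /= derivB derivXn derivC subr0 derivM zevalD !zevalM.
  rewrite (zeval_Phi z_prim) mulr0 add0r.
  apply: contra_eq_neq => ->.
  rewrite mul0r /zeval rmorphMn /= map_polyXn hornerMn hornerXn.
  by rewrite Num.Theory.mulrn_eq0 expf_eq0 (prim_root_eq0 z_prim) eqn0Ngt n_gt0 andbF.
have cancel (F : fieldType) (u v w p : F) : w != 0 ->
    u * p / v = - (w * p) * - (u / (v * w)).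
  by move=> w0; rewrite mulrNN invfM; move: (v^-1) => v1; field.
exists (- (ratfun U' / (ratfun V * ratfun W))).
exists (- (zeval z U' / (zeval z V * zeval z W))).
split; last first.
  by apply: evN; exists U', (V * W); rewrite ratfunM zevalM mulf_neq0.
have -> : uniformizer = - ratfun ('X^n - 1).
  by rewrite ratfunD ratfunN ratfun1 ratfunX opprB.
rewrite EW EU !ratfunM expr1; apply: cancel; exact: zeval_neq0 W0.
Qed.
End Order.

(** * Sums over blocks and over the upper half *)

Lemma count_odd n k : odd n ->
  (\sum_(0 <= j < k) (n %| 1 + 2 * j) = (k + n./2) %/ n)%N.
Proof.
move=> on; have n_gt0 : (0 < n)%N by case: n on.
elim: k => [|k IHk]; first by rewrite big_geq // divn_small //; lia.
rewrite big_nat_recr //= IHk addSn divnS // addnC; congr (nat_of_bool _ + _)%N.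
rewrite -[RHS](@Gauss_dvdr _ 2) ?coprimen2 //.
have -> : (2 * (k + n./2).+1 = (1 + 2 * k) + n)%N by lia.
by rewrite dvdn_addl.
Qed.

Lemma count_multiples n t k : (0 < n)%N -> coprime n t ->
  (\sum_(0 <= j < k) (n %| t + t * j) = k %/ n)%N.
Proof.
move=> n_gt0 co; elim: k => [|k IHk]; first by rewrite big_geq ?div0n.
by rewrite big_nat_recr //= IHk divnS // addnC -mulnS Gauss_dvdr.
Qed.

Lemma unit_term1E (F : fieldType) (x : F) k :
  unit_term x 1 k = (1 - x ^+ (8 * k + 1)) * unit_prefactor x k.
Proof.
rewrite /unit_term /unit_prefactor /coef_term !expr1n !mul1r !mulr1; ring.
Qed.

Lemma summandE k : summand k = unit_term q 1 k / (1 - q).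
Proof.
rewrite unit_term1E /summand /qnum /unit_prefactor.
rewrite -[qpoch q (q ^+ 2) k]/(poch q (q ^+ 2) k).
rewrite -[qpoch (q ^+ 6) _ k]/(poch (q ^+ 6) (q ^+ 6) k).
rewrite -[qpoch q (q ^+ 2) _]/(poch q (q ^+ 2) (2 * k)).
rewrite -[qpoch _ _ _]/(poch (q ^+ 2) (q ^+ 2) (2 * k)).
do 4!move: (poch _ _ _ : Qq) => ?.
rewrite !invfM; ring.
Qed.

Section Blocks.
Variables (n : nat) (z : algC).
Hypothesis n_gt3 : (3 < n)%N.
Hypothesis co_n_6 : coprime n 6.
Hypothesis z_prim : n.-primitive_root z.
Let n_gt0 : (0 < n)%N. Proof. by lia. Qed.
Let n_odd : odd n := coprime6_odd co_n_6.

Lemma z_neq0 : z != 0.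
Proof. by rewrite (prim_root_eq0 z_prim) eqn0Ngt n_gt0. Qed.

(** Of the factors 1 - q^(2j+1) with j < k, (k + n./2) %/ n are divisible by
    'Phi_n, and k %/ n of the factors 1 - q^(2j), or 1 - q^(6j), with 1 <= j <= k
    are. *)
Lemma order_eq_unit_prefactor s :
  order_eq n z (((2 * s + n./2) %/ n)%N%:Z - ((2 * s) %/ n)%N%:Z
    + ((((s + n./2) %/ n)%N%:Z - (s %/ n)%N%:Z) + (((s + n./2) %/ n)%N%:Z - (s %/ n)%N%:Z)))
    (unit_prefactor q s).
Proof.
have lo k : order_eq n z ((k + n./2) %/ n)%N (poch q (q ^+ 2) k).
  by rewrite -count_odd // -[X in poch X](expr1 q); apply: (order_eq_poch z_prim).
have le t k : (0 < t)%N -> coprime n t ->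
    order_eq n z (- (k %/ n)%N%:Z) (poch (q ^+ t) (q ^+ t) k)^-1.
  move=> t0 co; apply: order_eqV; rewrite -(count_multiples k n_gt0 co).
  exact: (order_eq_poch z_prim).
have l0 k : order_eq n z 0 (q ^+ k).
  by apply: (order_eq0 _ (evX k (evq z))); rewrite expf_neq0 ?z_neq0.
rewrite /unit_prefactor expr2; apply: (order_eqM z_prim); last first.
  by do 2!apply: (order_eqM z_prim) => //; apply: le.
rewrite -[X in order_eq _ _ X _]addr0; do 2!apply: (order_eqM z_prim) => //.
by apply: (le 2%N); rewrite ?coprimen2.
Qed.

Lemma order_ge_prefactor_block l : order_ge n z 0 (unit_prefactor q (l * n)).
Proof.
apply: (order_eq_ge z_prim) (order_eq_unit_prefactor _).
rewrite mulnA !divnMDl // !mulnK // !(@divn_small n./2); last by lia.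
by lia.
Qed.

Lemma order_ge_prefactor_half : order_ge n z 2 (unit_prefactor q ((n + 1) %/ 2)).
Proof.
apply: (order_eq_ge z_prim) (order_eq_unit_prefactor _).
have -> : (2 * ((n + 1) %/ 2) = 1 * n + 1)%N by lia.
have -> : ((n + 1) %/ 2 + n./2 = 1 * n)%N by lia.
rewrite -addnA !divnMDl // mulnK // (@divn_small (1 + _)); last by lia.
by rewrite (@divn_small 1) ?(@divn_small ((n + 1) %/ 2)) //; lia.
Qed.

(** Past the middle of a block, (q;q^2)_k has one more zero at z than (q^6;q^6)_k,
    while (q;q^2)_(2k) never has fewer than (q^2;q^2)_(2k). *)
Lemma ev_unit_term_tail l r : (n./2 < r < n)%N -> ev z (unit_term q 1 (l * n + r)) 0.
Proof.
move=> hr; rewrite unit_term1E; apply: (order_ge_gt0 z_prim (ltn0Sn 0)).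
rewrite -[1%N]add0n; apply: order_geM.
  apply: (@order_ge0 _ _ _ (1 - z ^+ (8 * (l * n + r) + 1))).
  by apply: evB (ev1 z) _; apply: evX; apply: evq.
apply: (order_eq_ge z_prim) (order_eq_unit_prefactor _).
rewrite mulnDr mulnA -(addnA _ (2 * r)%N) -(addnA _ r) !divnMDl //.
rewrite (@divn_small r); last by lia.
have h1 : ((r + n./2) %/ n = 1)%N.
  rewrite (_ : r + n./2 = 1 * n + (r + n./2 - n))%N; last by lia.
  by rewrite divnMDl // divn_small //; lia.
have h2 : (2 * r %/ n <= (2 * r + n./2) %/ n)%N by apply: leq_div2r; lia.
by rewrite h1; lia.
Qed.

Lemma ev_unit_term_sum (e : bool) y m : ev z y (z ^+ e) -> (m = ((n - 1) %/ 2 - e).+1)%N ->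
  ev z (\sum_(0 <= r < m) unit_term q y r) 0.
Proof.
move=> hy ->; rewrite -(unit_term_sum_eq0 n_gt3 co_n_6 z_prim e).
apply: ev_sum => r ltr; apply: ev_unit_term => //.
  by apply: (poch_cden_neq0 n_gt3) => //; lia.
by apply: (poch_gden_neq0 n_gt3) => //; lia.
Qed.

Lemma ev_half_block l :
  ev z (\sum_(0 <= r < (n + 1) %/ 2) unit_term q 1 (l * n + r)) 0.
Proof.
under eq_bigr => r _ do rewrite unit_term_split.
rewrite -mulr_sumr; have [c hc] := order_ge0_ev (order_ge_prefactor_block l).
rewrite -(mulr0 c); apply: evM => //; apply: (@ev_unit_term_sum false); last by lia.
have <- : z ^+ (2 * (l * n)) = z ^+ false.
  by rewrite mulnA mulnC exprM (prim_expr_order z_prim) expr1n.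
by apply: evX; apply: evq.
Qed.

Lemma ev_block l : ev z (\sum_(0 <= r < n) unit_term q 1 (l * n + r)) 0.
Proof.
have h : ((n + 1) %/ 2 <= n)%N by lia.
rewrite (big_cat_nat (leq0n _) h) /=.
rewrite -[X in ev _ _ X](addr0 0); apply: evD; first exact: ev_half_block.
have e : \sum_((n + 1) %/ 2 <= r < n) (0 : algC) = 0 by rewrite big1.
rewrite -[X in ev _ _ X]e.
by apply: ev_sum => r hr; apply: ev_unit_term_tail; lia.
Qed.

Lemma ev_blocks h : ev z (\sum_(0 <= k < h * n) unit_term q 1 k) 0.
Proof.
elim: h => [|h IHh]; first by rewrite mul0n big_geq //; apply: ev0.
have le : (h * n <= h.+1 * n)%N by rewrite leq_mul2r leqnSn orbT.
rewrite (big_cat_nat (leq0n _) le) /=.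
rewrite -[X in ev _ _ X](addr0 0); apply: evD => //.
rewrite -{1}[(h * n)%N]add0n big_addn mulSn addnK.
by under eq_bigr => k _ do rewrite addnC; apply: ev_block.
Qed.

Lemma ev_blocks_half h :
  ev z (\sum_(0 <= k < h * n + (n + 1) %/ 2) unit_term q 1 k) 0.
Proof.
rewrite (big_cat_nat (leq0n _) (leq_addr _ (h * n))) /=.
rewrite -[X in ev _ _ X](addr0 0); apply: evD; first exact: ev_blocks.
rewrite -{1}[(h * n)%N]add0n big_addn addKn.
by under eq_bigr => k _ do rewrite addnC; apply: ev_half_block.
Qed.

(** Here s = (n+1)/2 and y = q^(n+1), which is z at q = z: the shift e = 1. *)
Lemma order_ge_upper_half :
  order_ge n z 3 (\sum_((n + 1) %/ 2 <= k < n) unit_term q 1 k).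
Proof.
rewrite -{1}[((n + 1) %/ 2)%N]add0n big_addn.
under eq_bigr => r _ do rewrite addnC unit_term_split.
rewrite -mulr_sumr (_ : 3 = 2 + 1)%N //.
apply: order_geM; first exact: order_ge_prefactor_half.
apply: (ev0_order_ge1 z_prim); apply: (@ev_unit_term_sum true); last by lia.
have <- : z ^+ (2 * ((n + 1) %/ 2)) = z ^+ true.
  rewrite (_ : 2 * ((n + 1) %/ 2) = n + 1)%N; last by lia.
  by rewrite exprD (prim_expr_order z_prim) mul1r.
by apply: evX; apply: evq.
Qed.
End Blocks.

(** * The lower half *)

Lemma quad_inv (F : fieldType) (a u : F) : a != 0 -> quad a^-1 u = a ^- 2 * quad a u.
Proof. by move=> a0; rewrite /quad; field. Qed.

Lemma param_term_inv (F : fieldType) (x y a : F) k : a != 0 ->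
  param_term x y a^-1 k = param_term x y a k.
Proof.
move=> a0; rewrite /param_term; congr (_ * _).
have prodE (f : nat -> F) i : \prod_(i <= j < i + k) quad a^-1 (f j)
   = a ^- 2 ^+ k * \prod_(i <= j < i + k) quad a (f j).
  rewrite (eq_bigr (fun j => a ^- 2 * quad a (f j))) => [|j _]; last by rewrite quad_inv.
  by rewrite big_split prodr_const_nat addKn.
rewrite (prodE _ 0%N) -[k.+1]add1n (prodE _ 1%N) invfM mulrACA divff ?mul1r //.
by rewrite !(expf_neq0, invr_neq0).
Qed.

Section EvPoly.
Variables (z : algC).

Definition evpoly (P : {poly Qq}) (Q : {poly algC}) : Prop := forall i, ev z P`_i Q`_i.

Lemma evpolyD P P' Q Q' : evpoly P Q -> evpoly P' Q' -> evpoly (P + P') (Q + Q').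
Proof. by move=> h h' i; rewrite !coefD; apply: evD. Qed.

Lemma evpolyN P Q : evpoly P Q -> evpoly (- P) (- Q).
Proof. by move=> h i; rewrite !coefN; apply: evN. Qed.

Lemma evpolyM P P' Q Q' : evpoly P Q -> evpoly P' Q' -> evpoly (P * P') (Q * Q').
Proof.
move=> h h' i; rewrite !coefM -!(big_mkord xpredT (fun j => _`_j * _`_(i - j))).
by apply: ev_sum => j _; apply: evM.
Qed.

Lemma evpolyC x c : ev z x c -> evpoly x%:P c%:P.
Proof. by move=> h i; rewrite !coefC; case: eqP => // _; apply: ev0. Qed.

Lemma evpolyX : evpoly 'X 'X.
Proof. by move=> i; rewrite !coefX; case: eqP => _; [apply: ev1 | apply: ev0]. Qed.

Lemma evpoly_prod (f : nat -> {poly Qq}) (g : nat -> {poly algC}) i k :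
  (forall j, (i <= j < k)%N -> evpoly (f j) (g j)) ->
  evpoly (\prod_(i <= j < k) f j) (\prod_(i <= j < k) g j).
Proof.
move=> fg; rewrite big_nat [X in evpoly _ X]big_nat.
by apply: (big_ind2 evpoly) => //; [exact: evpolyC (ev1 z) | by move=> *; apply: evpolyM].
Qed.

Lemma evpoly_sum (f : nat -> {poly Qq}) (g : nat -> {poly algC}) i k :
  (forall j, (i <= j < k)%N -> evpoly (f j) (g j)) ->
  evpoly (\sum_(i <= j < k) f j) (\sum_(i <= j < k) g j).
Proof.
move=> fg; rewrite big_nat [X in evpoly _ X]big_nat.
by apply: (big_ind2 evpoly) => //; [exact: evpolyC (ev0 z) | by move=> *; apply: evpolyD].
Qed.

Lemma ev_quad_poly x c : ev z x c -> evpoly (quad_poly x) (quad_poly c).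
Proof.
move=> h; apply: evpolyM; apply: evpolyD; [exact: evpolyC (ev1 z) | | exact: evpolyX | ].
  by apply: evpolyN; apply: evpolyM (evpolyC h) evpolyX.
by apply: evpolyN; apply: evpolyC.
Qed.

Lemma ev_prod_quad_poly (s : nat -> nat) m i k :
  evpoly (\prod_(i <= j < k) quad_poly (1 ^+ m * q ^+ (s j)))
         (\prod_(i <= j < k) quad_poly (1 ^+ m * z ^+ (s j))).
Proof.
apply: evpoly_prod => j _; apply: ev_quad_poly.
by apply: evM; apply: evX; [apply: ev1 | apply: evq].
Qed.

Lemma evpoly_horner0 P x c : evpoly P 0 -> ev z x c -> ev z P.[x] 0.
Proof.
move=> h hx; rewrite horner_coef -(big_mkord xpredT (fun i => P`_i * x ^+ i)).
have e : \sum_(0 <= i < size P) (0 : algC) * c ^+ i = 0.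
  by rewrite big1 // => i _; rewrite mul0r.
rewrite -[X in ev _ _ X]e; apply: ev_sum => i _; apply: evM; last exact: evX.
by have := h i; rewrite coef0.
Qed.

(** Coefficients of the quotient are computed from the top by synthetic division,
    which stays inside the ideal of functions vanishing at z. *)
Lemma evpoly_factor P x c : evpoly P 0 -> root P x -> ev z x c ->
  exists2 P1, P = P1 * ('X - x%:P) & evpoly P1 0.
Proof.
move=> h /factor_theorem[P1 EP] hx; exists P1 => //.
suff: forall k i, (size P1 - i <= k)%N -> ev z P1`_i 0.
  by move=> h1 i; rewrite coef0; apply: h1 (leqnn _).
elim=> [|k IHk] i lti; first by rewrite nth_default; [exact: ev0 | rewrite -subn_eq0 -leqn0].
have -> : P1`_i = P`_i.+1 + P1`_i.+1 * x.
  by rewrite EP mulrBr coefB coefMX coefMC subrK.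
have := evD (h i.+1) (evM (IHk i.+1 _) hx); rewrite coef0 mul0r addr0; apply; lia.
Qed.
End EvPoly.

Section LowerHalf.
Variables (n : nat) (z : algC).
Hypothesis n_gt3 : (3 < n)%N.
Hypothesis co_n_6 : coprime n 6.
Hypothesis z_prim : n.-primitive_root z.
Let n_odd : odd n := coprime6_odd co_n_6.
Let K := ((n + 1) %/ 2)%N.

(** The term k = (n-1)/2 vanishes at z; the others have the common factor j = m
    more than in [numer_poly_eq0]. *)
Lemma ev_numer_poly : evpoly z (numer_poly q 1 K) 0.
Proof.
set m := ((n - 1) %/ 2)%N.
have Km : K = m.+1 by rewrite /K /m; lia.
have cm : coef_term z 1 m = 0.
  by have := coef_term_last n_gt3 co_n_6 z_prim false; rewrite subn0 expr0.
have nm : numer_poly z 1 m = 0.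
  by have := numer_poly_eq0 n_gt3 co_n_6 z_prim false; rewrite subn0 expr0.
have <- : numer_poly z 1 K = 0.
  rewrite Km /numer_poly big_nat_recr //= cm mulr0 scale0r addr0.
  transitivity (numer_poly z 1 m * quad_poly (1 ^+ 3 * z ^+ (6 * m))); last by rewrite nm mul0r.
  rewrite /numer_poly mulr_suml; apply: eq_big_nat => k /andP[_ ltk].
  by rewrite -scalerAl /term_poly big_nat_recr //= mulrA.
rewrite /numer_poly; apply: (@evpoly_sum z _ _ 0 K) => k ltk.
rewrite -!mul_polyC; apply: evpolyM.
  apply: evpolyC; apply: evM.
    apply: evB (ev1 z) _; apply: evM; apply: evX; [exact: ev1 | exact: evq].
  apply: ev_coef_term (ev1 z) _.
  have := @poch_cden_neq0 n _ z n_gt3 co_n_6 z_prim false k.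
  by rewrite expr0; apply; rewrite -/m; lia.
apply: evpolyM; first exact: (@ev_prod_quad_poly z (fun j => 2 * j + 1)%N 1).
exact: (@ev_prod_quad_poly z (fun j => 6 * j)%N 3).
Qed.

(** M = (numerator) - R (denominator) has coefficients vanishing at z and the two
    roots q^n and q^-n, so M.[1] is (1 - q^n)(1 - q^-n) times a value that
    vanishes at z. *)
Lemma order_ge_lower_half :
  order_ge n z 3 (\sum_(0 <= k < K) unit_term q 1 k - terminating_value q n).
Proof.
set R := terminating_value q n.
have hR : ev z R 0.
  by apply: ev_terminating_value z_prim; [lia | exact: dvdnn].
have qX0 i : q ^+ i != 0 by rewrite expf_neq0 ?q_neq0.
have den_odd a : a = q ^+ n \/ a = q ^- n ->
    forall j, quad a (1 ^+ 3 * q ^+ (6 * j)) != 0.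
  have qq i j : i != j -> q ^+ i - q ^+ j != 0.
    by rewrite subr_eq0 (expq_inj q_neq0 q_expr_neq1).
  have base j : quad (q ^+ n) (1 ^+ 3 * q ^+ (6 * j)) != 0.
    rewrite expr1n mul1r /quad mulf_neq0 // ?qq //; last by lia.
    by rewrite -exprD -(expr0 q) qq //; lia.
  case=> -> j; first exact: base.
  rewrite (quad_inv _ (qX0 n)) mulf_neq0 ?base // invr_neq0 //; exact: expf_neq0 (qX0 n).
have den_one j : (0 < j < K)%N -> exists2 c, ev z (quad 1 (1 ^+ 3 * q ^+ (6 * j))) c & c != 0.
  move=> ltj; exists (quad 1 (z ^+ (6 * j))).
    have hq := evX (6 * j) (evq z).
    rewrite expr1n mul1r /quad; apply: evM; last by apply: evB (ev1 z) _.
    by apply: evB (ev1 z) _; apply: evM (ev1 z) _.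
  have h : 1 - z ^+ (6 * j) != 0.
    rewrite subr_eq0 exprM -(expr0 (z ^+ 6)); rewrite /K in ltj.
    by rewrite (prim_expr_neq (prim6 co_n_6 z_prim)) //; lia.
  by rewrite /quad mul1r mulf_neq0.
have hD : exists2 c, ev z (denom_poly q 1 K).[1] c & c != 0.
  rewrite /denom_poly horner_prod_quad_poly big_nat.
  apply: (big_ind (fun x => exists2 c, ev z x c & c != 0)).
  - by exists 1; [exact: ev1 | exact: oner_neq0].
  - move=> x x' [c hc c0] [c' hc' c0']; exists (c * c'); [exact: evM | exact: mulf_neq0].
  - by move=> j hj; apply: den_one.
have sumR : \sum_(0 <= k < K) param_term q 1 (q ^- n) k = R.
  rewrite /R -(terminating q_neq0 q_expr_neq1 (m := K) co_n_6); last by rewrite /K; lia.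
  rewrite mulr_sumr; apply: eq_bigr => k _; rewrite param_termE ?expr1n //.
  by have := den_odd _ (or_intror erefl) 0%N; rewrite muln0 expr0 mulr1 expr1n.
pose M := numer_poly q 1 K - R%:P * denom_poly q 1 K.
have hM : evpoly z M 0.
  have -> : 0 = 0 - 0%:P * denom_poly z 1 K by rewrite mul0r subr0.
  apply: evpolyD ev_numer_poly _; apply: evpolyN; apply: evpolyM; first exact: evpolyC.
  exact: (@ev_prod_quad_poly z (fun j => 6 * j)%N 3).
have hqn : ev z (q ^+ n) 1 by rewrite -(prim_expr_order z_prim); apply: evX; apply: evq.
have hqV : ev z (q ^- n) 1 by have := evV hqn (oner_neq0 _); rewrite invr1.
have MR x : (forall j, (0 < j < K)%N -> quad x (1 ^+ 3 * q ^+ (6 * j)) != 0) ->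
    M.[x] = (denom_poly q 1 K).[x] * (\sum_(0 <= k < K) param_term q 1 x k - R).
  move=> hx; rewrite /M hornerD hornerN hornerM hornerC (horner_numer_poly hx).
  by rewrite [R * _]mulrC -mulrBr.
have M1 : root M (q ^- n).
  apply/eqP; rewrite (MR _ (fun j _ => den_odd _ (or_intror erefl) j)).
  by rewrite sumR subrr mulr0.
have M2 : root M (q ^+ n).
  apply/eqP; rewrite (MR _ (fun j _ => den_odd _ (or_introl erefl) j)).
  have -> : \sum_(0 <= k < K) param_term q 1 (q ^+ n) k = R.
    rewrite -sumR; apply: eq_bigr => k _.
    exact: esym (@param_term_inv _ q 1 (q ^+ n) k (qX0 n)).
  by rewrite subrr mulr0.
have [N EN hN] := evpoly_factor hM M1 hqV.
have [L EL hL] : exists2 L, N = L * ('X - (q ^+ n)%:P) & evpoly z L 0.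
  apply: evpoly_factor hN _ hqn.
  move: M2; rewrite EN rootM root_XsubC => /orP[// | /eqP e].
  have nn : (0 < n + n)%N by lia.
  have e2 : q ^+ (n + n) = 1.
    rewrite exprD; exact: etrans (congr1 (fun x => x * q ^+ n) e) (mulVf (qX0 n)).
  case/negP: (q_expr_neq1 nn); apply/eqP; exact: e2.
have ML : M.[1] = (1 - q ^+ n) ^+ 2 * (- q ^- n * L.[1]).
  rewrite EN hornerM hornerXsubC EL hornerM hornerXsubC.
  have comb (F : fieldType) (x l : F) : x != 0 ->
      l * (1 - x) * (1 - x^-1) = (1 - x) ^+ 2 * (- x^-1 * l) by move=> x0; field.
  exact: comb.
have nz1 j : (0 < j < K)%N -> quad 1 (1 ^+ 3 * q ^+ (6 * j)) != 0.
  move=> /andP[j0 _]; rewrite expr1n mul1r /quad mul1r.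
  have h : 1 - q ^+ (6 * j) != 0.
    rewrite subr_eq0 eq_sym; apply: q_expr_neq1; lia.
  exact: (mulf_neq0 h h).
have D0 : (denom_poly q 1 K).[1] != 0.
  rewrite /denom_poly horner_prod_quad_poly big_nat_cond prodf_seq_neq0.
  by apply/allP => j _; apply/implyP => /andP[hj _]; apply: nz1.
have -> : \sum_(0 <= k < K) unit_term q 1 k - R = M.[1] / (denom_poly q 1 K).[1].
  rewrite (MR _ nz1) mulrAC (mulfV D0) mul1r; congr (_ - _).
  by apply: eq_bigr => k _; rewrite param_term_at1.
have [c hc c0] := hD; rewrite ML -mulrA -[3%N]/(2 + (1 + 0))%N; apply: order_geM.
  by exists 1, 1; rewrite mulr1; split=> //; apply: ev1.
apply: order_geM; last exact: order_ge0 (evV hc c0).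
apply: (ev0_order_ge1 z_prim); rewrite -[X in ev _ _ X](mulr0 (- 1)).
by apply: evM; [exact: evN | exact: evpoly_horner0 hL (ev1 z)].
Qed.
End LowerHalf.

(** * From orders to the congruences *)

(** Dividing by the primitive part of the gcd keeps numerator and denominator in
    Z[q]; coprimality is meant in Q[q]. *)
Lemma lowest_terms (x : Qq) :
  exists A B : Zq, [/\ B != 0, x = ratfun A / ratfun B & coprimep A B].
Proof.
have [U [V [V0 ->]]] := ratfunP x.
set g := zprimitive (gcdp U V).
have [[A EA] [B EB]] := (dvdpP_int (dvdp_gcdl U V), dvdpP_int (dvdp_gcdr U V)).
rewrite -/g in EA EB; have := V0; rewrite EB mulf_eq0 negb_or => /andP[g0 B0].
exists A, B; split=> //.
  have g0' : ratfun g != 0 by rewrite ratfun_eq0.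
  by rewrite EA !ratfunM -mulf_div (divff g0') mul1r.
have := eqp_size (gcdp_mul2l g A B); rewrite -EA -EB.
have G0 : gcdp A B != 0 by rewrite gcdp_eq0 (negPf B0) andbF.
have sg : size g = size (gcdp U V) by rewrite size_zprimitive.
have g_gt0 : (0 < size g)%N by rewrite size_poly_gt0.
rewrite -sg size_mul // /coprimep; move: g_gt0.
by move: (size g) (size (gcdp A B)) => a b; lia.
Qed.

Lemma coprimep_prod_seq (I : eqType) (r : seq I) (f : I -> Zq) (B : Zq) :
  {in r, forall i, coprimep (f i) B} -> coprimep (\prod_(i <- r) f i) B.
Proof.
move=> h; rewrite big_seq; apply: (big_ind (fun p => coprimep p B)) => //.
- exact: coprime1p.
- by move=> p p'; rewrite coprimepMl => -> ->.
Qed.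

Lemma dvdp_prod_seq (I : eqType) (r : seq I) (f : I -> Zq) (A : Zq) : uniq r ->
  {in r &, forall i j, i != j -> coprimep (f i) (f j)} ->
  {in r, forall i, f i %| A} -> \prod_(i <- r) f i %| A.
Proof.
elim: r => [|i r IHr] /=; first by rewrite big_nil dvd1p.
move=> /andP[ir ur] cop dv; rewrite big_cons Gauss_dvdp.
  rewrite dv ?mem_head //=; apply: IHr => // [j k jr kr|j jr].
    by apply: cop; rewrite inE ?jr ?kr orbT.
  by apply: dv; rewrite inE jr orbT.
rewrite coprimep_sym; apply: coprimep_prod_seq => j jr.
apply: cop; rewrite ?mem_head // ?inE ?jr ?orbT //.
by apply: contraNneq ir => <-.
Qed.

Lemma coprimep_cyclotomic d d' : (0 < d)%N -> (0 < d')%N -> d != d' ->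
  coprimep 'Phi_d 'Phi_d'.
Proof.
move=> d0 d'0 dd'; have [z zp] := C_prim_root_exists d0.
have [z' zp'] := C_prim_root_exists d'0.
apply: (coprimep_Phi zp); apply: contraNneq dd' => e0.
have : root (map_poly intr 'Phi_d') z by apply/eqP.
rewrite (Cintr_Cyclotomic zp') (root_cyclotomic zp') => zp2.
rewrite eqn_dvd (prim_order_dvd zp) (prim_order_dvd zp2).
by rewrite (prim_expr_order zp) (prim_expr_order zp2) eqxx.
Qed.

Definition modulus_exp (n d : nat) : nat := if d == n then 3 else 1.

Lemma modulusE n : (1 < n)%N ->
  qnum_poly n * 'Phi_n ^+ 2
  = \prod_(d <- [seq d <- divisors n | d != 1]) 'Phi_d ^+ modulus_exp n d.
Proof.
move=> n1; have n0 : (0 < n)%N by lia.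
have Phi1 : 'Phi_1 = 'X - 1.
  by have := prod_Cyclotomic (ltn0Sn 0); rewrite big_seq1 expr1.
have qn : qnum_poly n = \prod_(d <- [seq d <- divisors n | d != 1]) 'Phi_d.
  apply: (@mulfI _ ('X - 1)); first by rewrite -size_poly_eq0 size_XsubC.
  rewrite /qnum_poly big_mkord -subrX1 -prod_Cyclotomic // big_filter.
  by rewrite (bigD1_seq 1%N) ?divisors_uniq -?dvdn_divisors ?dvd1n //= Phi1.
have nin : n \in [seq d <- divisors n | d != 1].
  by rewrite mem_filter -dvdn_divisors // dvdnn andbT; lia.
have un : uniq [seq d <- divisors n | d != 1] by rewrite filter_uniq ?divisors_uniq.
rewrite qn !(bigD1_seq n) //= /modulus_exp eqxx mulrAC -exprS; congr (_ * _).
by apply: eq_bigr => d /negPf ->; rewrite expr1.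
Qed.

(** Write S - R = A / B in lowest terms.  Each 'Phi_d^(e_d) divides A, hence so
    does their product, which is then coprime to B.  The division is exact over Z
    because the modulus is monic, and for the same reason a common divisor with B,
    being constant, is a unit. *)
Lemma congr_of_orders (n : nat) (S R : Qq) : (1 < n)%N ->
  (forall d z, (d %| n)%N -> (1 < d)%N -> d.-primitive_root z ->
     order_ge d z (modulus_exp n d) (S - R)) ->
  congr_ratfun S R (qnum_poly n * 'Phi_n ^+ 2).
Proof.
move=> n1 ord; have n0 : (0 < n)%N by lia.
have [A [B [B0 EAB cAB]]] := lowest_terms (S - R).
rewrite modulusE //; set ds := [seq d <- divisors n | d != 1].
have dsP d : d \in ds -> (d %| n)%N /\ (1 < d)%N.
  rewrite mem_filter -dvdn_divisors // => /andP[d1 dn].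
  by have := dvdn_gt0 n0 dn; split=> //; lia.
have dvA d : d \in ds -> 'Phi_d ^+ modulus_exp n d %| A.
  move=> /dsP[dn d1]; have [z zp] : {z : algC | d.-primitive_root z}.
    by apply: C_prim_root_exists; lia.
  have [y [c [Ey [U [V [V0 EV _]]]]]] := ord d z dn d1 zp.
  have V0' := zeval_neq0 V0.
  have E : A * V = (1 - 'X^d) ^+ modulus_exp n d * U * B.
    have pE : uniformizer d = ratfun (1 - 'X^d) by rewrite ratfunD ratfunN ratfun1 ratfunX.
    have clear (F : fieldType) (a b u v p : F) : b != 0 -> v != 0 ->
        a / b = p * (u / v) -> a * v = p * u * b.
      by move=> b0 v0 h; rewrite -[a](divfK b0) h; field.
    have B0' : ratfun B != 0 by rewrite ratfun_eq0.
    rewrite EV pE -ratfunX EAB in Ey; have := clear _ _ _ _ _ _ B0' V0' Ey.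
    by rewrite -!ratfunM => /eqP; rewrite tofrac_eq => /eqP.
  have cV : coprimep ('Phi_d ^+ modulus_exp n d) V by apply: coprimep_expl; apply: coprimep_Phi zp V0.
  rewrite -(Gauss_dvdpl _ cV) E -mulrA dvdp_mulr // dvdp_exp2r //.
  rewrite -opprB -mulN1r dvdp_mull //.
  rewrite -prod_Cyclotomic; last by lia.
  rewrite (big_rem d) /=; last by rewrite -dvdn_divisors //; lia.
  exact: dvdp_mulIl.
have mP : \prod_(d <- ds) 'Phi_d ^+ modulus_exp n d \is monic.
  by apply: monic_prod => d _; apply: monic_exp; apply: Cyclotomic_monic.
exists A, B; split=> //.
  have : \prod_(d <- ds) 'Phi_d ^+ modulus_exp n d %| A.
    apply: dvdp_prod_seq => //; first by rewrite filter_uniq ?divisors_uniq.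
    move=> d d' /dsP[_ d1] /dsP[_ d1'] dd'; apply: coprimep_expl; apply: coprimep_expr.
    by apply: coprimep_cyclotomic => //; lia.
  by move=> /dvdpP_int[Q ->]; exists Q; rewrite zprimitive_monic // mulrC.
have cPB : coprimep (\prod_(d <- ds) 'Phi_d ^+ modulus_exp n d) B.
  by apply: coprimep_prod_seq => d hd; apply: coprimep_dvdr cAB; apply: dvA.
move=> D [Q1 E1] [Q2 E2].
have : D %= 1.
  by move/coprimepP: cPB; apply; [rewrite E1 | rewrite E2]; apply: dvdp_mulIr.
rewrite -size_poly_eq1 => sD; rewrite poly_unitE sD /=.
have <- : lead_coef D = D`_0 by rewrite lead_coefE (eqP sD).
have := congr1 lead_coef E1; rewrite lead_coefM (monicP mP) => h.
by apply/unitrP; exists (lead_coef Q1); split; [rewrite -h | rewrite mulrC -h].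
Qed.

Lemma congr_refl (A : Qq) (P : Zq) : congr_ratfun A A P.
Proof.
exists 0, 1; split.
- exact: oner_neq0.
- by rewrite subrr /ratfun tofrac0 mul0r.
- by exists 0; rewrite mul0r.
- by move=> D _ [Q E]; apply/unitrP; exists Q; rewrite [D * Q]mulrC -E.
Qed.

Lemma congr_sum_summand (n m : nat) : (1 < n)%N -> coprime n 6 ->
  (forall d z, (d %| n)%N -> (1 < d)%N -> d.-primitive_root z ->
     order_ge d z (modulus_exp n d) (\sum_(0 <= k < m) unit_term q 1 k - terminating_value q n)) ->
  congr_ratfun (\sum_(0 <= k < m) summand k)
    (q ^- ((n - 1) %/ 2) * qnum n * (legendre_m3 n)%:~R) (qnum_poly n * 'Phi_n ^+ 2).
Proof.
move=> n1 co ord; apply: congr_of_orders => // d z dn d1 zp.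
have -> : \sum_(0 <= k < m) summand k - q ^- ((n - 1) %/ 2) * qnum n * (legendre_m3 n)%:~R
  = (\sum_(0 <= k < m) unit_term q 1 k - terminating_value q n) * (1 - q)^-1.
  rewrite mulrBl mulr_suml; congr (_ - _).
    by apply: eq_bigr => k _; exact: summandE.
  by rewrite /terminating_value /qnum mulrA mulrAC.
rewrite -[modulus_exp n d]addn0; apply: order_geM; first exact: ord.
apply: order_ge0; apply: evV; first by apply: evB (ev1 z) (evq z).
by rewrite subr_eq0 eq_sym -(expr1 z) -(prim_order_dvd zp) dvdn1; lia.
Qed.

Theorem theorem1p1 (n : nat) (n_gt0 : (0 < n)%N) (co_n_6 : coprime n 6) :
  congr_ratfun
    (\sum_(0 <= k < n) summand k)
    (q ^- ((n - 1) %/ 2) * qnum n * (legendre_m3 n)%:~R)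
    (qnum_poly n * 'Phi_n ^+ 2)
  /\
  congr_ratfun
    (\sum_(0 <= k < ((n - 1) %/ 2).+1) summand k)
    (q ^- ((n - 1) %/ 2) * qnum n * (legendre_m3 n)%:~R)
    (qnum_poly n * 'Phi_n ^+ 2).
Proof.
have [n1|n1] := leqP n 1.
  have -> : n = 1%N by lia.
  have -> : \sum_(0 <= k < 1) summand k = q ^- ((1 - 1) %/ 2) * qnum 1 * (legendre_m3 1)%:~R.
    rewrite big_nat1 /summand /qpoch !muln0 !big_geq // /legendre_m3 /= !expr0.
    by rewrite !expr1n !mulr1 invr1 !mul1r.
  by split; exact: congr_refl.
have n_odd := coprime6_odd co_n_6.
have cod d : (d %| n)%N -> coprime d 6 by move=> dn; apply: coprime_dvdl co_n_6.
have gt3 d : (d %| n)%N -> (1 < d)%N -> (3 < d)%N.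
  move=> dn d1; have := cod d dn; case: d d1 {dn} => [|[|[|[|d]]]] //.
have hR d z : (d %| n)%N -> d.-primitive_root z -> ev z (terminating_value q n) 0.
  exact: ev_terminating_value.
have half : ((n - 1) %/ 2).+1 = ((n + 1) %/ 2)%N by lia.
rewrite half; split; apply: congr_sum_summand => // d z dn d1 zp; rewrite /modulus_exp.
  case: eqP => [dE|_]; [rewrite dE in zp * |].
    (* d = n: the sum splits into its two halves, each of order 3. *)
    have le : ((n + 1) %/ 2 <= n)%N by lia.
    rewrite (big_cat_nat (leq0n _) le) /= addrAC; apply: order_geD.
      by apply: order_ge_lower_half => //; apply: gt3.
    by apply: order_ge_upper_half => //; apply: gt3.
  apply: (ev0_order_ge1 zp); rewrite -[X in ev _ _ X](subr0 0); apply: evB; last exact: hR zp.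
  by rewrite -(divnK dn); apply: ev_blocks; rewrite ?gt3 ?cod.
case: eqP => [dE|_]; [rewrite dE in zp * |].
  by apply: order_ge_lower_half => //; apply: gt3.
apply: (ev0_order_ge1 zp); rewrite -[X in ev _ _ X](subr0 0); apply: evB; last exact: hR zp.
(* n / d is odd, so the lower half is a number of blocks plus half a block. *)
have -> : ((n + 1) %/ 2 = (n %/ d) %/ 2 * d + (d + 1) %/ 2)%N.
  have d_odd := coprime6_odd (cod d dn).
  have : odd (n %/ d) by move: n_odd; rewrite -{1}(divnK dn) oddM => /andP[].
  by move: (divnK dn) d_odd; move: (n %/ d)%N => h; nia.
by apply: ev_blocks_half; rewrite ?gt3 ?cod.
Qed.
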